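(* Let $m\ge2$ be an integer, let $f^{\mathrm{II}}_m:\mathbb{C}\setminus\{0\}\to S^3_1$ be the exceptional catenoid of type II, and let $\gamma_m$ and $\mathcal{C}^{\mathrm{II}}_m\subset S^3_1$ be as defined in the context. Then $\mathcal{C}^{\mathrm{II}}_m$ gives the real analytic extension of $f^{\mathrm{II}}_m$ (in the sense made explicit in the context), and has the following properties: (i) The projection of $\mathcal{C}^{\mathrm{II}}_m$ into the $xy$-plane in $\mathbb{R}^4_1$ is the (image of the) hypo-trochoid $-\gamma_m$. Furthermore, for each point $(a,b)$ of this hypo-trochoid, the section of $\mathcal{C}^{\mathrm{II}}_m$ by the plane $\{(t,a,b,z);t,z\in\mathbb{R}\}$, which contains the point and is perpendicular to the $xy$-plane, is a hyperbola unless this plane passes through a cone-like singularity of $\mathcal{C}^{\mathrm{II}}_m$. (ii) $\mathcal{C}^{\mathrm{II}}_m$ is almost immersed and has exactly four endpoints; two of them lie in $\partial_+S^3_1$ and the other two lie in $\partial_-S^3_1$. Moreover, $\mathcal{C}^{\mathrm{II}}_m$ is almost embedded if $m=2$ or $m=3$. (iii) If $m$ is odd, then $\mathcal{C}^{\mathrm{II}}_m$ is the closure in $S^3_1$ of the image of $f^{\mathrm{II}}_m$. If $m$ is even, then the closure $K$ in $S^3_1$ of the image of $f^{\mathrm{II}}_m$ is just half of $\mathcal{C}^{\mathrm{II}}_m$, and the other half is obtained by the isometric involution $\iota(t,x,y,z)=(-t,x,y,-z)$ of $S^3_1$; that is, $K\subsetneq\mathcal{C}^{\mathrm{II}}_m$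 and $\mathcal{C}^{\mathrm{II}}_m=K\cup\iota(K)$.
   Context: $\mathbb{R}^4_1$ is Lorentz–Minkowski 4-space with coordinates $(t,x,y,z)$ and metric of signature $(-+++)$; $S^3_1=\{X\in\mathbb{R}^4_1;\langle X,X\rangle=1\}$ is de Sitter 3-space. Identifying $(t,x,y,z)$ with $\begin{pmatrix}t+z & x+\mathrm{i}y \\ x-\mathrm{i}y & t-z\end{pmatrix}$, one has $S^3_1=\{ae_3a^*;a\in \mathrm{SL}(2,\mathbb{C})\}$, $e_3=\begin{pmatrix}1&0\\0&-1\end{pmatrix}$, $a^*$ the conjugate transpose. The exceptional catenoid of type II is $f^{\mathrm{II}}_m=F^{\mathrm{II}}_me_3(F^{\mathrm{II}}_m)^*$ with $$F^{\mathrm{II}}_m=\frac{z^{-\frac{m+1}{2}}}{2\sqrt{2m}}\begin{pmatrix}z\bigl((1-m)z^m+m+1\bigr)&z\bigl((m-1)z^m+m+1\bigr)\\-(m+1)z^m+m-1&(m+1)z^m+m-1\end{pmatrix}.$$ With $z=re^{\mathrm{i}\theta}$, its components $(x_0,x_1,x_2,x_3)$ in the coordinates $(t,x,y,z)$ are $$x_0=\frac{1-m^2}{4m}\Bigl(r+\frac1r\Bigr)\cos m\theta,\qquad x_3=\frac{1-m^2}{4m}\Bigl(r-\frac1r\Bigr)\cos m\theta,$$ $$x_1=-\frac{(m^2+1)\cos m\theta\cos\theta+2m\sin m\theta\sin\theta}{2m},\qquad x_2=-\frac{(m^2+1)\cos m\theta\sin\theta-2m\sin m\theta\cos\theta}{2m}.$$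 Let $\gamma_m(\theta)=\frac{(m-1)^2}{4m}e^{\mathrm{i}(m+1)\theta}+\frac{(m+1)^2}{4m}e^{-\mathrm{i}(m-1)\theta}\in\mathbb{C}\cong\mathbb{R}^2$; this curve is a hypo-trochoid, and $(x_1,x_2)=-\gamma_m(\theta)$. Define $$\mathcal{C}^{\mathrm{II}}_m:=\Bigl\{(t,x,y,z)\in\mathbb{R}^4_1;\ (x,y)=-\gamma_m(\theta),\ t^2-z^2=\frac{(m^2-1)^2}{(2m)^2}\cos^2m\theta\ \text{ for some }\theta\in[0,2\pi)\Bigr\}\subset S^3_1 .$$ The cone-like singularities of $\mathcal{C}^{\mathrm{II}}_m$ are the points $(-1)^k(0,-\sin\alpha_k,\cos\alpha_k,0)$ with $\alpha_k=\frac{(2k+1)\pi}{2m}$, $k=0,\dots,2m-1$ (the images under $f^{\mathrm{II}}_m$ of the singular rays $\cos m\theta=0$). That $\mathcal{C}^{\mathrm{II}}_m$ gives the real analytic extension of $f^{\mathrm{II}}_m$ means: $\mathcal{C}^{\mathrm{II}}_m$ contains the image of $f^{\mathrm{II}}_m$, and there are a discrete subset $D\subset\mathcal{C}^{\mathrm{II}}_m$, a real analytic 2-manifold $M$ and a real analytic immersion $\Phi:M\to S^3_1$ with $\Phi(M)=\mathcal{C}^{\mathrm{II}}_m\setminus D$ such that every connected component of $M$ contains a nonempty open subset mapped by $\Phi$ into the image of $f^{\mathrm{II}}_m$. A subset $\mathcal{A}$ of a manifold $N$ is called almost embedded (resp. almost immersed) if there is a discrete subset $D$ of $\mathcal{A}$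 such that $\mathcal{A}\setminus D$ is the image of an embedding (resp. an immersion) of a manifold into $N$. The stereographic hollow ball model is $\varPi:S^3_1\to\mathbb{R}^3$, $\varPi(t,x,y,z)=\frac1\delta(x,y,z)$ with $\delta=t+\sqrt{2t^2+1}$; its image is $\mathcal{D}^3=\{\xi\in\mathbb{R}^3;\sqrt2-1<|\xi|<\sqrt2+1\}$. The ideal boundaries of $S^3_1$ are $\partial_\pm S^3_1=\{\xi\in\mathbb{R}^3;|\xi|=\sqrt2\mp1\}$. For a closed subset $\mathcal{A}\subset S^3_1$, an endpoint of $\mathcal{A}$ is an element of $\overline{\varPi(\mathcal{A})}\cap\partial\mathcal{D}^3$ (closure in $\mathbb{R}^3$). *)

(* Defs.v *)
From HB Require Import structures.
From mathcomp Require Import all_boot all_order all_algebra.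
From mathcomp Require Import complex.
From mathcomp Require Import all_classical all_reals all_analysis.
From mathcomp Require Import ring lra.
Set Implicit Arguments.
Unset Strict Implicit.
Unset Printing Implicit Defensive.
Import Order.TTheory GRing.Theory Num.Theory.
Import numFieldNormedType.Exports.
Local Open Scope classical_set_scope.
Local Open Scope ring_scope.

Section Regularity.
Context {R : realType}.

Definition monomial_term n (c : {ffun 'I_n -> nat} -> R) (h : 'rV[R]_n)
    (a : {ffun 'I_n -> nat}) : R :=
  c a * \prod_(i < n) h 0 i ^+ a i.

(* sum over the multi-indices all of whose entries are < N *)
Definition cube_sum n (F : {ffun 'I_n -> nat} -> R) (N : nat) : R :=
  \sum_(a : {ffun 'I_n -> 'I_N}) F [ffun i => val (a i)].

(* Near p, f is the sum of an absolutely convergent power series in n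
   variables; absolute convergence makes the choice of partial sums
   (here over cubes) irrelevant. *)
Definition analytic_at n (f : 'rV[R]_n -> R) (p : 'rV[R]_n) : Prop :=
  exists (c : {ffun 'I_n -> nat} -> R) (r : R), 0 < r /\
    forall h : 'rV[R]_n, `|h| < r ->
      cvgn (cube_sum (fun a => `|monomial_term c h a|)) /\
      cube_sum (monomial_term c h) @ \oo --> f (p + h).

Definition analytic_on n k (U : set 'rV[R]_n) (g : 'rV[R]_n -> 'rV[R]_k) : Prop :=
  forall p, U p -> forall j, analytic_at (fun x => g x 0 j) p.

(* g is of class C^l on the open set U *)
Fixpoint Ck (l : nat) n k (U : set 'rV[R]_n) (g : 'rV[R]_n -> 'rV[R]_k) : Prop :=
  if l is l'.+1 then
    (forall p, U p -> differentiable g p) /\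
    (forall i : 'I_n, Ck l' U (fun p => 'D_(delta_mx 0 i) g p))
  else {within U, continuous g}.

Definition smooth_on n k (U : set 'rV[R]_n) (g : 'rV[R]_n -> 'rV[R]_k) : Prop :=
  forall l, Ck l U g.

End Regularity.

Section Manifolds.
Context {R : realType}.

(* A homeomorphism from an open subset of M onto an open subset of R^n; the
   two underlying functions are total, and irrelevant outside these sets. *)
Record chart (M : topologicalType) (n : nat) := Chart {
  chart_dom : set M;
  chart_map : M -> 'rV[R]_n;
  chart_inv : 'rV[R]_n -> M;
  chart_dom_open : open chart_dom;
  chart_cod_open : open (chart_map @` chart_dom);
  chart_mapK : forall x, chart_dom x -> chart_inv (chart_map x) = x;
  chart_map_cont : {within chart_dom, continuous chart_map};
  chart_inv_cont : {within chart_map @` chart_dom, continuous chart_inv}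
}.

Definition chart_cod (M : topologicalType) n (c : chart M n) : set 'rV[R]_n :=
  chart_map c @` chart_dom c.

(* The class of regularity (smooth_on or analytic_on) is a parameter. *)
Definition regularity :=
  forall n k : nat, set 'rV[R]_n -> ('rV[R]_n -> 'rV[R]_k) -> Prop.

Record manifold (reg : regularity) (n : nat) := Manifold {
  mfd_sort :> topologicalType;
  mfd_atlas : set (chart mfd_sort n);
  mfd_hausdorff : hausdorff_space mfd_sort;
  mfd_second_countable : @second_countable mfd_sort;
  mfd_cover : forall x, exists2 c, mfd_atlas c & chart_dom c x;
  mfd_transition : forall c d, mfd_atlas c -> mfd_atlas d ->
    reg n n (chart_map c @` (chart_dom c `&` chart_dom d))
            (chart_map d \o chart_inv c)
}.

(* N stands for an embedded submanifold of R^k, so that a map into N is regular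
   (resp. an immersion) iff it is so as a map into R^k. *)
Definition immersion (reg : regularity) n (M : manifold reg n) k
    (N : set 'rV[R]_k) (Phi : M -> 'rV[R]_k) : Prop :=
  (forall x, N (Phi x)) /\
  forall c, mfd_atlas c ->
    reg n k (chart_cod c) (Phi \o chart_inv c) /\
    forall p, chart_cod c p -> injective ('d (Phi \o chart_inv c) p).

(* an injective immersion which is a homeomorphism onto its image *)
Definition embedding (reg : regularity) n (M : manifold reg n) k
    (N : set 'rV[R]_k) (Phi : M -> 'rV[R]_k) : Prop :=
  [/\ immersion N Phi, injective Phi, continuous Phi &
      forall U : set M, open U ->
        exists2 V : set 'rV[R]_k, open V & Phi @` U = V `&` range Phi].

Definition discrete_subset (T : topologicalType) (A D : set T) : Prop :=
  D `<=` A /\ D `<=` isolated D.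

Definition almost_immersed k (N A : set 'rV[R]_k) : Prop :=
  exists D, discrete_subset A D /\
  exists n (M : manifold (@smooth_on R) n) (Phi : M -> 'rV[R]_k),
    immersion N Phi /\ range Phi = A `\` D.

Definition almost_embedded k (N A : set 'rV[R]_k) : Prop :=
  exists D, discrete_subset A D /\
  exists n (M : manifold (@smooth_on R) n) (Phi : M -> 'rV[R]_k),
    embedding N Phi /\ range Phi = A `\` D.

(* A gives the real analytic extension of a surface in N with image I. *)
Definition analytic_extension k (N A I : set 'rV[R]_k) : Prop :=
  I `<=` A /\
  exists D, discrete_subset A D /\
  exists (M : manifold (@analytic_on R) 2) (Phi : M -> 'rV[R]_k),
    [/\ immersion N Phi, range Phi = A `\` D &
        forall x : M, exists U : set M,
          [/\ open U, U !=set0, U `<=` connected_component setT x &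
              Phi @` U `<=` I]].

End Manifolds.

Section DeSitter.
Context {R : realType}.

(* points of R^4_1 are row vectors (t, x, y, z) *)
Definition vec4 (t x y z : R) : 'rV[R]_4 := \row_(i < 4) [:: t; x; y; z]`_i.
Definition crd_t (X : 'rV[R]_4) : R := X 0 (inord 0).
Definition crd_x (X : 'rV[R]_4) : R := X 0 (inord 1).
Definition crd_y (X : 'rV[R]_4) : R := X 0 (inord 2).
Definition crd_z (X : 'rV[R]_4) : R := X 0 (inord 3).

Definition lorentz (X Y : 'rV[R]_4) : R :=
  - (crd_t X * crd_t Y) + crd_x X * crd_x Y + crd_y X * crd_y Y
  + crd_z X * crd_z Y.

Definition dS3 : set 'rV[R]_4 := [set X | lorentz X X = 1].

Definition closure_dS3 (A : set 'rV[R]_4) : set 'rV[R]_4 := closure A `&` dS3.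

Definition mx2 (a b c d : R[i]) : 'M[R[i]]_2 :=
  \matrix_(i, j) (if i == 0 then (if j == 0 then a else b)
                  else (if j == 0 then c else d)).

(* identification of R^4_1 with Hermitian matrices, and its inverse *)
Definition herm (X : 'rV[R]_4) : 'M[R[i]]_2 :=
  mx2 (Complex (crd_t X + crd_z X) 0) (Complex (crd_x X) (crd_y X))
      (Complex (crd_x X) (- crd_y X)) (Complex (crd_t X - crd_z X) 0).

Definition unherm (H : 'M[R[i]]_2) : 'rV[R]_4 :=
  vec4 (complex.Re (H 0 0 + H 1 1) / 2) (complex.Re (H 0 1))
       (complex.Im (H 0 1)) (complex.Re (H 0 0 - H 1 1) / 2).

Definition adjoint (a : 'M[R[i]]_2) : 'M[R[i]]_2 := map_mx Num.conj a^T.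

Lemma crd_vec4 t x y z : let X := vec4 t x y z in
  (crd_t X = t) * (crd_x X = x) * (crd_y X = y) * (crd_z X = z).
Proof. by rewrite /crd_t /crd_x /crd_y /crd_z /vec4 /= !mxE !inordK. Qed.

Lemma vec4_crd X : vec4 (crd_t X) (crd_x X) (crd_y X) (crd_z X) = X.
Proof.
apply/rowP => -[i lti]; rewrite mxE /=.
by move: i lti => [|[|[|[|//]]]] lti /=; congr (X _ _); apply/val_inj;
  rewrite /= inordK.
Qed.

Lemma hermK : cancel herm unherm.
Proof.
move=> X; rewrite -[RHS]vec4_crd /unherm /herm !mxE /=.
by congr vec4; rewrite addrC ?opprD ?opprK -?addrA; set t := crd_t X;
  set z := crd_z X; field.
Qed.

Lemma unhermK H : adjoint H = H -> herm (unherm H) = H.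
Proof.
move=> adjH; apply/matrixP => i j.
have adjE k l : conjc (H l k) = H k l by rewrite -{2}adjH !mxE.
have ordE (k : 'I_2) : k = 0 \/ k = 1.
  by case: k => -[|[|//]] ltk; [left|right]; apply/val_inj.
have := (adjE 0 0, adjE 1 1, adjE 1 0).
case E00: (H 0 0) => [a a']; case E11: (H 1 1) => [d d'].
case E01: (H 0 1) => [b b']; case E10: (H 1 0) => [c c'] /=.
case=> -[[Ea] [Ed]] [Ec Ec'].
have a0 : a' = 0 by lra.
have d0 : d' = 0 by lra.
by case: (ordE i) => ->; case: (ordE j) => ->;
  rewrite !mxE /= !crd_vec4 ?E00 ?E11 ?E01 ?E10 /= -?Ec -?Ec' ?a0 ?d0;
  congr Complex; field.
Qed.

Definition e3 : 'M[R[i]]_2 := mx2 1 0 0 (- 1).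

(* z^{-(m+1)/2} is sqrt(z)^{-(m+1)} for a choice of square root; the sign does
   not affect F e3 F^*. *)
Definition FII (m : nat) (z : R[i]) : 'M[R[i]]_2 :=
  let M : R[i] := m%:R in
  (sqrtC z ^- m.+1 / (2 * sqrtC (2 * M))) *:
  mx2 (z * ((1 - M) * z ^+ m + M + 1)) (z * ((M - 1) * z ^+ m + M + 1))
      (- (M + 1) * z ^+ m + M - 1) ((M + 1) * z ^+ m + M - 1).

Definition fII (m : nat) (z : R[i]) : 'rV[R]_4 :=
  unherm (FII m z *m e3 *m adjoint (FII m z)).

Definition fII_image (m : nat) : set 'rV[R]_4 := fII m @` [set z | z != 0].

Definition cis (t : R) : R[i] := Complex (cos t) (sin t).

Definition gamma (m : nat) (theta : R) : R[i] :=
  Complex ((m%:R - 1) ^+ 2 / (4 * m%:R)) 0 * cis ((m%:R + 1) * theta) +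
  Complex ((m%:R + 1) ^+ 2 / (4 * m%:R)) 0 * cis (- (m%:R - 1) * theta).

Definition CII (m : nat) : set 'rV[R]_4 :=
  [set X | exists theta : R, [/\ 0 <= theta < 2 * pi,
     Complex (crd_x X) (crd_y X) = - gamma m theta &
     crd_t X ^+ 2 - crd_z X ^+ 2 =
       (m%:R ^+ 2 - 1) ^+ 2 / (2 * m%:R) ^+ 2 * cos (m%:R * theta) ^+ 2]].

Definition cone_like_singularities (m : nat) : set 'rV[R]_4 :=
  [set X | exists k : nat, (k < 2 * m)%N /\
     let alpha : R := (2 * k%:R + 1) * pi / (2 * m%:R) in
     X = (-1) ^+ k *: vec4 0 (- sin alpha) (cos alpha) 0].

Definition xy_projection (X : 'rV[R]_4) : R[i] := Complex (crd_x X) (crd_y X).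

Definition hypotrochoid (m : nat) : set R[i] := range (fun t => - gamma m t).

Definition vertical_plane (a b : R) : set 'rV[R]_4 :=
  [set X | crd_x X = a /\ crd_y X = b].

(* the part of A in the vertical plane, in the coordinates (t, z) of that plane *)
Definition vertical_section (A : set 'rV[R]_4) (a b : R) : set (R * R) :=
  (fun X => (crd_t X, crd_z X)) @` (A `&` vertical_plane a b).

(* a nondegenerate conic of hyperbolic type; the last condition is the
   nonvanishing of the determinant of the 3 x 3 matrix of the conic *)
Definition is_hyperbola (S : set (R * R)) : Prop :=
  exists a b c d e f : R,
    [/\ S = [set p | a * p.1 ^+ 2 + 2 * b * p.1 * p.2 + c * p.2 ^+ 2
                     + 2 * d * p.1 + 2 * e * p.2 + f = 0],
        b ^+ 2 - a * c > 0 &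
        a * (c * f - e ^+ 2) - b * (b * f - d * e) + d * (b * e - c * d) != 0].

(* `|_| is the sup norm on row vectors *)
Definition enorm n (v : 'rV[R]_n) : R := Num.sqrt (\sum_(i < n) v 0 i ^+ 2).

Definition hollow_ball_proj (X : 'rV[R]_4) : 'rV[R]_3 :=
  (crd_t X + Num.sqrt (2 * crd_t X ^+ 2 + 1))^-1 *:
  \row_(i < 3) [:: crd_x X; crd_y X; crd_z X]`_i.

Definition hollow_ball : set 'rV[R]_3 :=
  [set xi | Num.sqrt 2 - 1 < enorm xi < Num.sqrt 2 + 1].

Definition ideal_boundary_plus : set 'rV[R]_3 :=
  [set xi | enorm xi = Num.sqrt 2 - 1].
Definition ideal_boundary_minus : set 'rV[R]_3 :=
  [set xi | enorm xi = Num.sqrt 2 + 1].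

Definition topological_boundary (T : topologicalType) (A : set T) : set T :=
  closure A `\` interior A.

Definition endpoints (A : set 'rV[R]_4) : set 'rV[R]_3 :=
  closure (hollow_ball_proj @` A) `&` topological_boundary hollow_ball.

Definition iota_dS3 (X : 'rV[R]_4) : 'rV[R]_4 :=
  vec4 (- crd_t X) (crd_x X) (crd_y X) (- crd_z X).

End DeSitter.

Arguments dS3 R : clear implicits.
Arguments fII_image R m : clear implicits.
Arguments CII R m : clear implicits.
Arguments cone_like_singularities R m : clear implicits.
Arguments hypotrochoid R m : clear implicits.
Arguments ideal_boundary_plus R : clear implicits.
Arguments ideal_boundary_minus R : clear implicits.

(* Main.v *)
Require Import Defs.
From HB Require Import structures.
From mathcomp Require Import all_boot all_order all_algebra.
From mathcomp Require Import complex.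
From mathcomp Require Import all_classical all_reals all_analysis.
From mathcomp Require Import ring lra.
Set Implicit Arguments.
Unset Strict Implicit.
Unset Printing Implicit Defensive.
Import Order.TTheory GRing.Theory Num.Theory.
Import numFieldNormedType.Exports.
Local Open Scope classical_set_scope.
Local Open Scope ring_scope.

(** In the light-cone coordinates u = t + z and v = t - z, and with polar
    coordinates (r, theta) on the plane of z, the catenoid is
      u = - a r cos (m theta),   v = - (a / r) cos (m theta),
      (x, y) = - gamma_m (theta),   where a = (m^2 - 1) / (2 m)
    ([fII_polar]).  Since |gamma_m (theta)|^2 = 1 + a^2 cos^2 (m theta)
    ([gamma_norm]), the set CII of the statement is the set of all points of de
    Sitter space whose projection to the xy-plane lies on the curve - gamma_m
    ([CII_dS3]).  Over theta it consists of the points with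
    u v = a^2 cos^2 (m theta), and the image of the catenoid is the part of it
    where u cos (m theta) < 0, together with the cone-like singularities, where
    cos (m theta) = u = v = 0 ([fII_image_lightpt]).  Everything else is read
    off this description.

    Sections.  Over a point (p, q) of the curve the surface is
    t^2 - z^2 = p^2 + q^2 - 1, however often the curve passes through that
    point; the right-hand side vanishes only at cone-like
    singularities ([section_hyperbola]).

    Closure.  Where cos (m theta) = 0, the fibre u v = 0 is a pair of light-like
    lines, and both lie in the closure of the catenoid ([closure_light_line]).
    The remaining points have u cos (m theta) > 0.  If m is odd, then
    theta + pi gives the same point of the curve and the opposite sign of the
    cosine, so that these points are already in the image of the catenoid
    ([CII_odd]).  For every m, iota changes the signs of u and v, whence the
    decomposition into two halves ([CII_iota]); if m is even the first half is
    not everything, because - gamma_m (0) is not equal to - gamma_m (theta)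
    for any theta with cos (m theta) <= 0 ([closure_image_even]).

    Analytic extension.  Away from the cone-like singularities one of u and v is
    nonzero, so it is equal to exp s or - exp s for some s, and the equation
    gives the other one as an analytic function of (s, theta).  These are four
    analytic maps from the plane ([patch]), which together cover the complement
    of the singularities.  They are immersions because gamma_m is a regular
    curve ([dgamma_neq0]).  On each of them u cos (m theta) < 0 somewhere, so
    each meets the catenoid.  The same four maps show that CII is almost
    immersed.

    Endpoints.  With delta the denominator in the hollow ball model and xi the
    image of a point of de Sitter space, 1 / delta^2 is a polynomial in |xi|^2
    which vanishes on the ideal boundary ([sqnorm_proj]).  As x and y are
    bounded on CII, the first two coordinates of an endpoint vanish; this leaves
    two points on each of the two spheres, and the ends of a light-like line
    reach all four ([closure_proj_CII_bound], [axis_point_closure]).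

    Embeddedness.  For m = 2 and m = 3 the curve - gamma_m is simple
    ([profile2], [profile3]).  Then CII is the union of the graphs
    t = sqrt (z^2 + x^2 + y^2 - 1) and t = - sqrt (z^2 + x^2 + y^2 - 1) over the
    product of the curve and the z-axis, and these graphs meet exactly at the
    cone-like singularities ([half_sheet], [half_sheets_inverse]).

    Differentiability of every order and analyticity follow from closure
    properties: the smooth maps at hand are built from a few functions whose
    partial derivatives are of the same kind ([elementary]), and the analytic
    ones are sums of products of one-variable entire functions ([entire],
    [analytic_at_prod]).  The abstract surfaces are disjoint unions of copies of
    an open set of the plane ([sheets]). *)

(** * Differentiability and smoothness are local; a class of smooth functions *)

(** The function is its own remainder in the first-order expansion with zero
    linear part, which reduces the locality of differentiability to the
    differentiability of a sum. *)
Lemma differentiable_near0 (R : realType) (V W : normedModType R)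
  (h : V -> W) p :
  (\near p, h p = 0) -> differentiable h p.
Proof.
move=> h0; have hp := nbhs_singleton h0.
pose z : {linear V -> W} := \0.
have E : h \o shift p = cst (h p) + z +o_ 0 id.
  apply/eqaddoP => _/posnumP[e]; near=> x.
  have -> : (h \o shift p - (cst (h p) + z : V -> W)) x
    = h (x + p) - (h p + 0) by [].
  rewrite hp addr0 subr0 (_ : h (x + p) = 0) ?normr0 ?mulr_ge0//.
  near: x; have := h0; rewrite (near_shift 0)/=.
  by apply: filterS => y /=; rewrite subr0.
apply/diff_locallyP; rewrite (diff_unique _ E); last by move=> ?;
  exact: cvg_cst.
by split => // ?; exact: cvg_cst.
Unshelve. all: by end_near. Qed.

Lemma near_eq_differentiable (R : realType) (V W : normedModType R)
    (f g : V -> W) p :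
  (\near p, f p = g p) -> differentiable g p -> differentiable f p.
Proof.
move=> fg dg; have -> : f = g + (f - g) by rewrite addrC subrK.
apply: differentiableD => //; apply: differentiable_near0.
by apply: filterS fg => x; rewrite fctE => ->; rewrite subrr.
Qed.

Lemma near_eq_diff (R : realType) (V W : normedModType R)
    (f g : V -> W) p v :
  (\near p, f p = g p) -> differentiable g p -> 'd f p v = 'D_v g p.
Proof.
move=> fg dg; rewrite -deriveE; last exact: near_eq_differentiable dg.
exact: near_eq_derive.
Qed.

Lemma derive_crd {R : realType} n (p h : 'rV[R]_n) i :
  'D_h (fun x : 'rV[R]_n => x 0 i) p = h 0 i.
Proof.
have := derive_id p h; rewrite (derive_mx (M := id)); last exact: derivable_id.
by move=> /matrixP/(_ 0 i); rewrite !mxE.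
Qed.

Lemma derive_component {R : realType} n k (F : 'rV[R]_n -> 'rV[R]_k) p h :
  differentiable F p ->
  'D_h F p = 0 -> forall j, 'D_h (fun x => F x 0 j) p = 0.
Proof.
move=> dF; rewrite derive_mx; last exact: diff_derivable.
by move=> /rowP + j => /(_ j); rewrite !mxE.
Qed.

(** The maps are total while regularity only concerns U.  Equality on the open
    set U passes to the partial derivatives, so induction on the order works. *)
Lemma Ck_local (R : realType) l n k (U : set 'rV[R]_n)
    (F G : 'rV[R]_n -> 'rV[R]_k) :
  open U -> (forall x, U x -> F x = G x) -> Ck l U G -> Ck l U F.
Proof.
move=> oU; elim: l F G => [|l IHl] F G FG /=.
  apply: subspace_eq_continuous => x /set_mem Ux; exact/esym/FG.
have FGn p : U p -> \near p, F p = G p.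
  by move=> Up; near=> x; apply: FG; near: x; exact: open_nbhs_nbhs.
move=> [dG cG]; split=> [p Up|i].
  exact: near_eq_differentiable (FGn p Up) (dG p Up).
by apply: IHl (cG i) => p Up; exact: near_eq_derive (FGn p Up).
Unshelve. all: by end_near. Qed.

Lemma smooth_on_local {R : realType} n k (U : set 'rV[R]_n)
  (f g : 'rV[R]_n -> 'rV[R]_k) :
  open U -> (forall x, U x -> f x = g x) -> smooth_on U g -> smooth_on U f.
Proof. by move=> oU fg sg l; exact: Ck_local oU fg (sg l). Qed.

Section SmoothCalculus.
Context {R : realType} (n : nat) (U : set 'rV[R]_n).

(** Each rule differentiates into an expression built by the same rules, so
    membership gives differentiability of all orders at once.  The side
    conditions for the inverse, the root and the logarithm are only required on
    the open set U, since the functions are total. *)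
Inductive elementary : ('rV[R]_n -> R) -> Prop :=
| elementary_cst c : elementary (fun=> c)
| elementary_crd i : elementary (fun x => x 0 i)
| elementaryD f g : elementary f -> elementary g ->
    elementary (fun x => f x + g x)
| elementaryM f g : elementary f -> elementary g ->
    elementary (fun x => f x * g x)
| elementaryV f : elementary f -> (forall x, U x -> f x != 0) ->
    elementary (fun x => (f x)^-1)
| elementary_sqrt f : elementary f -> (forall x, U x -> 0 < f x) ->
    elementary (fun x => Num.sqrt (f x))
| elementary_ln f : elementary f -> (forall x, U x -> 0 < f x) ->
    elementary (fun x => ln (f x))
| elementary_expR f : elementary f -> elementary (fun x => expR (f x))
| elementary_cos f : elementary f -> elementary (fun x => cos (f x))
| elementary_sin f : elementary f -> elementary (fun x => sin (f x)).

Lemma differentiable_chain (phi : R -> R) (f : 'rV[R]_n -> R) p v d :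
  differentiable f p -> is_derive (f p) 1 phi d ->
  differentiable (fun x => phi (f x)) p /\
  'D_v (fun x => phi (f x)) p = d * 'D_v f p.
Proof.
move=> df [dphi dE].
have dphi' : differentiable phi (f p) by apply/derivable1_diffP.
split; first exact: differentiable_comp.
rewrite !deriveE//; last exact: differentiable_comp.
by rewrite (diff_comp df dphi')/= deriv1E//= derive1E dE mulrC.
Qed.

Lemma elementary_differentiable f : elementary f ->
  forall p, U p -> differentiable f p.
Proof.
elim=> {f} [c|i|f g _ IHf _ IHg|f g _ IHf _ IHg|f _ IHf f0|f _ IHf f0|f _ IHf f0
  |f _ IHf|f _ IHf|f _ IHf] p Up.
- exact: differentiable_cst.
- exact: differentiable_coord.
- exact: differentiableD (IHf p Up) (IHg p Up).
- exact: differentiableM (IHf p Up) (IHg p Up).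
- exact: differentiableV (IHf p Up) (f0 p Up).
- exact: (differentiable_chain 0 (IHf p Up) (is_derive1_sqrt (f0 p Up))).1.
- exact: (differentiable_chain 0 (IHf p Up) (is_derive1_ln (f0 p Up))).1.
- exact: (differentiable_chain 0 (IHf p Up) (is_derive_expR _)).1.
- exact: (differentiable_chain 0 (IHf p Up) (is_derive_cos _)).1.
- exact: (differentiable_chain 0 (IHf p Up) (is_derive_sin _)).1.
Qed.

(** This closure under derivatives is what makes the class useful. *)
Lemma elementary_derive f v : elementary f ->
  exists2 f', elementary f' & forall p, U p -> 'D_v f p = f' p.
Proof.
elim=> {f} [c|i|f g Ef [f' Ef' IHf] Eg [g' Eg' IHg]
  |f g Ef [f' Ef' IHf] Eg [g' Eg' IHg]
  |f Ef [f' Ef' IHf] f0|f Ef [f' Ef' IHf] f0|f Ef [f' Ef' IHf] f0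
  |f Ef [f' Ef' IHf]|f Ef [f' Ef' IHf]|f Ef [f' Ef' IHf]].
- exists (fun=> 0); first exact: elementary_cst.
  by move=> p Up; rewrite derive_cst.
- exists (fun=> v 0 i); first exact: elementary_cst.
  by move=> p Up; exact: derive_crd.
- exists (fun x => f' x + g' x); first exact: elementaryD.
  move=> p Up; rewrite -IHf// -IHg// -[LHS]/('D_v (f + g) p) deriveD//;
    exact/diff_derivable/elementary_differentiable.
- exists (fun x => f x * g' x + g x * f' x).
    by apply: elementaryD; apply: elementaryM.
  move=> p Up; rewrite -IHf// -IHg// -[LHS]/('D_v (f * g) p) deriveM//;
    exact/diff_derivable/elementary_differentiable.
- exists (fun x => - 1 * ((f x)^-1 * (f x)^-1 * f' x)).
    by do !apply: elementaryM => //; [exact: elementary_cst|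
      exact: elementaryV|exact: elementaryV].
  move=> p Up; rewrite deriveV ?f0//; last first.
    exact/diff_derivable/elementary_differentiable.
  by rewrite IHf// /GRing.scale/= expr2 invfM; ring.
- exists (fun x => (2 * Num.sqrt (f x))^-1 * f' x).
    apply: elementaryM => //; apply: elementaryV.
      by apply: elementaryM; [exact: elementary_cst|exact: elementary_sqrt].
    by move=> x Ux; rewrite mulf_neq0// gt_eqF// sqrtr_gt0 f0.
  move=> p Up; rewrite -IHf//.
  exact: (differentiable_chain v (elementary_differentiable Ef Up)
    (is_derive1_sqrt (f0 p Up))).2.
- exists (fun x => (f x)^-1 * f' x).
    apply: elementaryM => //; apply: elementaryV => // x Ux.
    by rewrite gt_eqF// f0.
  move=> p Up; rewrite -IHf//.
  exact: (differentiable_chain v (elementary_differentiable Ef Up)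
    (is_derive1_ln (f0 p Up))).2.
- exists (fun x => expR (f x) * f' x).
    by apply: elementaryM => //; exact: elementary_expR.
  move=> p Up; rewrite -IHf//.
  exact: (differentiable_chain v (elementary_differentiable Ef Up)
    (is_derive_expR _)).2.
- exists (fun x => - 1 * sin (f x) * f' x).
    apply: elementaryM => //; apply: elementaryM; first exact: elementary_cst.
    exact: elementary_sin.
  move=> p Up; rewrite -IHf// mulN1r.
  exact: (differentiable_chain v (elementary_differentiable Ef Up)
    (is_derive_cos _)).2.
- exists (fun x => cos (f x) * f' x).
    by apply: elementaryM => //; exact: elementary_cos.
  move=> p Up; rewrite -IHf//.
  exact: (differentiable_chain v (elementary_differentiable Ef Up)
    (is_derive_sin _)).2.
Qed.

Lemma elementary_continuous f x : elementary f -> U x -> {for x, continuous f}.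
Proof.
by move=> ef Ux; exact/differentiable_continuous/(elementary_differentiable ef).
Qed.

Lemma differentiable_row k (F : 'rV[R]_n -> 'rV[R]_k) p :
  (forall j, differentiable (fun x => F x 0 j) p) -> differentiable F p.
Proof.
move=> dF.
have -> : F = \sum_(j < k) (fun x => F x 0 j *: delta_mx 0 j).
  by apply/funext => x; rewrite fct_sumE -row_sum_delta.
by apply: differentiable_sum => j; exact: differentiableZl.
Qed.

(** Induction on the order: the partial derivatives of a map with elementary
    components again have elementary components, up to equality on U. *)
Lemma elementary_smooth k (F : 'rV[R]_n -> 'rV[R]_k) : open U ->
  (forall j, elementary (fun x => F x 0 j)) -> smooth_on U F.
Proof.
move=> oU EF l; elim: l F EF => [|l IHl] F EF /=.
  have dF p : U p -> {for p, continuous F}.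
    move=> Up; apply/differentiable_continuous/differentiable_row => j.
    exact: elementary_differentiable.
  by rewrite continuous_open_subspace// => p /set_mem; exact: dF.
have dF p : U p -> differentiable F p.
  by move=> Up; apply: differentiable_row => j;
    exact: elementary_differentiable.
split=> // i.
have /choice[f' f'P] : forall j, exists f', elementary f' /\
    forall p, U p -> 'D_(delta_mx 0 i) (fun x => F x 0 j) p = f' p.
  by move=> j; have [f' ? ?] := elementary_derive (delta_mx 0 i) (EF j);
    exists f'.
apply: (Ck_local oU) (IHl (fun x => \row_j f' j x) _) => [p Up|j].
  rewrite derive_mx; last exact/diff_derivable/dF.
  by apply/rowP => j; rewrite !mxE (f'P j).2.
have -> : (fun x => (\row_j f' j x) 0 j) = f' j.
  by apply/funext => x; rewrite mxE.
exact: (f'P j).1.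
Qed.

Lemma elementaryN f : elementary f -> elementary (fun x => - f x).
Proof.
move=> Ef; under eq_fun do rewrite -mulN1r.
by apply: elementaryM => //; exact: elementary_cst.
Qed.

Lemma elementaryB f g : elementary f -> elementary g ->
  elementary (fun x => f x - g x).
Proof. by move=> Ef Eg; apply: elementaryD => //; exact: elementaryN. Qed.

Lemma elementary_sqr f : elementary f -> elementary (fun x => f x ^+ 2).
Proof. by move=> Ef; under eq_fun do rewrite expr2; exact: elementaryM. Qed.

End SmoothCalculus.

Lemma derive_of_crd {R : realType} n (phi : R -> R) (p h : 'rV[R]_n) i d :
  is_derive (p 0 i) 1 phi d ->
  'D_h (fun x : 'rV[R]_n => phi (x 0 i)) p = d * h 0 i.
Proof.
by move=> /(differentiable_chain h (differentiable_coord p 0 i))[_ ->];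
  rewrite derive_crd.
Qed.

Lemma smooth_on_id {R : realType} n (U : set 'rV[R]_n) : open U ->
  smooth_on U id.
Proof. by move=> oU; apply: elementary_smooth => // j;
  exact: elementary_crd. Qed.

Ltac prove_elementary := repeat first
  [ exact: elementary_cst | exact: elementary_crd | assumption
  | apply: elementaryN | apply: elementaryB | apply: elementaryD
  | apply: elementary_sqr | apply: elementaryM
  | apply: elementary_expR | apply: elementary_cos | apply: elementary_sin ].

(** * Power series in several variables *)

Section AnalyticCalculus.
Context {R : realType}.

(** Everywhere expandable in a power series that is dominated, coefficient by
    coefficient, by C exp (k h).  The explicit majorant gives absolute
    convergence for free; it is satisfied by the affine maps, the exponentials
    and the trigonometric functions. *)
Definition entire (f : R -> R) : Prop :=
  forall x, exists (a : R^nat) (C k : R),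
    (forall i, `|a i| <= C * (k ^+ i / i`!%:R)) /\
    forall h, series (fun i => a i * h ^+ i) @ \oo --> f (x + h).

Lemma cvg_series_majorized (a : R^nat) (C k h : R) :
  (forall i, `|a i| <= C * (k ^+ i / i`!%:R)) ->
  cvgn (series (fun i => `|a i * h ^+ i|)).
Proof.
move=> aC.
have le i : `|a i * h ^+ i| <= C * exp_coeff (k * `|h|) i.
  rewrite normrM normrX /exp_coeff/= exprMn mulrAC mulrA.
  by apply: ler_wpM2r; [exact: exprn_ge0|exact: aC].
apply: (@series_le_cvg _ _ (fun i => C * exp_coeff (k * `|h|) i)) => //.
- by move=> i; exact: le_trans (le i).
- exact: (is_cvg_seriesZ (k := C)) (is_cvg_series_exp_coeff _).
Qed.

Lemma entire_affine (b c : R) : entire (fun x => b + c * x).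
Proof.
move=> x; exists (fun i => [:: b + c * x; c]`_i), (`|b + c * x| + `|c|), 1.
split=> [[|[|i]]|h] /=.
- by rewrite expr0 fact0 divr1 mulr1 lerDl.
- by rewrite expr1 divr1 mulr1 lerDr.
- by rewrite nth_nil normr0 mulr_ge0// ?addr_ge0// expr1n divr_ge0.
- apply: cvg_near_cst; exists 2%N => // -[|[|n]] //= _.
  rewrite /series/= !big_nat_recl// big1 => [|i _];
    last by rewrite /= nth_nil mul0r.
  by rewrite /= expr0 expr1 !mulr1 addr0 mulrDr addrA.
Qed.

Lemma entire_expR k : entire (fun x => expR (k * x)).
Proof.
move=> x; exists (fun i => expR (k * x) * (k ^+ i / i`!%:R)), (expR (k * x)),
  `|k|.
split=> [i|h].
  by rewrite !normrM normfV normrX (ger0_norm (expR_ge0 _)) normr_nat.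
rewrite mulrDr expRD.
have -> : (fun i => expR (k * x) * (k ^+ i / i`!%:R) * h ^+ i) =
    expR (k * x) *: exp_coeff (k * h).
  apply/funext => i; rewrite /exp_coeff/= -[RHS]/(_ * (_ * _)).
  by rewrite exprMn -!mulrA; congr (_ * (_ * _)); rewrite mulrC.
by rewrite seriesZ; apply: cvgMr; exact: is_cvg_series_exp_coeff.
Qed.

(** The two functions are treated together because the expansion of either at
    a point involves both. *)
Lemma entire_trig (b c k : R) : entire (fun x =>
  b * cos (k * x) + c * sin (k * x)).
Proof.
move=> x.
pose B := b * cos (k * x) + c * sin (k * x).
pose C := c * cos (k * x) - b * sin (k * x).
pose cc := fun i => (~~ odd i)%:R * (-1) ^+ i./2 / i`!%:R : R.
pose sc := fun i => (odd i)%:R * (-1) ^+ i.-1./2 / i`!%:R : R.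
exists (fun i => B * (cc i * k ^+ i) + C * (sc i * k ^+ i)), (`|B| + `|C|),
  `|k|.
split=> [i|h].
  have cE : `|cc i| <= i`!%:R^-1.
    rewrite /cc !normrM normrX normrN1 expr1n mulr1 normfV !normr_nat.
    by rewrite ler_piMl// lern1 leq_b1.
  have sE : `|sc i| <= i`!%:R^-1.
    rewrite /sc !normrM normrX normrN1 expr1n mulr1 normfV !normr_nat.
    by rewrite ler_piMl// lern1 leq_b1.
  apply: le_trans (ler_normD _ _) _; rewrite 2!normrM [`|C * _|]normrM
    [`|sc _ * _|]normrM normrX mulrDl.
  by apply: lerD; apply: ler_wpM2l => //; rewrite mulrC;
    apply: ler_wpM2l => //; exact: exprn_ge0.
have -> : (fun i => (B * (cc i * k ^+ i) + C * (sc i * k ^+ i)) * h ^+ i) =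
    B *: cos_coeff (k * h) + C *: sin_coeff (k * h).
  apply/funext => i; rewrite cos_coeffE sin_coeffE /cc /sc.
  rewrite -[RHS]/(_ * (_ * _) + _ * (_ * _)) exprMn; ring.
have -> : b * cos (k * (x + h)) + c * sin (k * (x + h)) =
    B * cos (k * h) + C * sin (k * h).
  by rewrite mulrDr cosD sinD /B /C; ring.
rewrite seriesD !seriesZ; apply: cvgD; apply: cvgMr.
  by rewrite unlock; exact: is_cvg_series_cos_coeff.
by rewrite unlock; exact: is_cvg_series_sin_coeff.
Qed.

Lemma entire_one : entire (fun=> 1).
Proof.
have -> : (fun=> 1) = (fun x => 1 + 0 * x) :> (R -> R).
  by apply/funext => x; rewrite mul0r addr0.
exact: entire_affine.
Qed.

Lemma entire_cos k : entire (fun x => cos (k * x)).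
Proof.
have -> : (fun x => cos (k * x)) = (fun x => 1 * cos (k * x) + 0 * sin (k * x)).
  by apply/funext => x; rewrite mul1r mul0r addr0.
exact: entire_trig.
Qed.

Lemma entire_sin k : entire (fun x => sin (k * x)).
Proof.
have -> : (fun x => sin (k * x)) = (fun x => 0 * cos (k * x) + 1 * sin (k * x)).
  by apply/funext => x; rewrite mul1r mul0r add0r.
exact: entire_trig.
Qed.

Lemma cvgn_prod (I : Type) (s : seq I) (u : I -> R^nat) (l : I -> R) :
  (forall i, u i @ \oo --> l i) ->
  (fun N => \prod_(i <- s) u i N) @ \oo --> \prod_(i <- s) l i.
Proof.
move=> ul; elim: s => [|i s IHs].
  by under eq_fun do rewrite big_nil; rewrite big_nil; exact: cvg_cst.
by under eq_fun do rewrite big_cons; rewrite big_cons; exact: cvgM.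
Qed.

(** Partial sums over cubes of multi-indices factor exactly, before any limit is
    taken, so the convergence of a product of series in separate variables is
    the convergence of the factors. *)
Lemma cube_sum_prod n (u : 'I_n -> R^nat) (F : {ffun 'I_n -> nat} -> R) N :
  (forall a, F a = \prod_i u i (a i)) ->
  cube_sum F N = \prod_i series (u i) N.
Proof.
move=> FE; rewrite /cube_sum.
under [RHS]eq_bigr do rewrite /series/= big_mkord.
rewrite bigA_distr_bigA; apply: eq_bigr => a _; rewrite FE.
by apply: eq_bigr => i _; rewrite ffunE.
Qed.

Lemma analytic_at_prod n (f : 'I_n -> R -> R) p :
  (forall i, entire (f i)) ->
  analytic_at (fun x : 'rV[R]_n => \prod_i f i (x 0 i)) p.
Proof.
move=> ef; have /choice[a aP] := fun i => ef i (p 0 i).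
exists (fun s => \prod_i a i (s i)), 1; split=> // h _; split.
  apply/cvg_ex; exists (\prod_i limn (series (fun j => `|a i j * h 0 i ^+ j|))).
  have -> : cube_sum (fun s => `|monomial_term
    (fun s => \prod_i a i (s i)) h s|)
     = (fun N => \prod_i series (fun j => `|a i j * h 0 i ^+ j|) N).
    apply/funext => N; apply: cube_sum_prod => s.
    by rewrite /monomial_term -big_split normr_prod.
  apply: cvgn_prod => i; have [C [k [aC _]]] := aP i.
  exact: cvg_series_majorized aC.
have -> : cube_sum (monomial_term (fun s => \prod_i a i (s i)) h)
     = (fun N => \prod_i series (fun j => a i j * h 0 i ^+ j) N).
  apply/funext => N; apply: cube_sum_prod => s.
  by rewrite /monomial_term -big_split.
apply: cvgn_prod => i; have [C [k [_ +]]] := aP i.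
by move=> /(_ (h 0 i)); rewrite mxE.
Qed.

(** A small cube of multi-indices embeds into a larger one. *)
Lemma cube_sum_nondecreasing n (F : {ffun 'I_n -> nat} -> R) :
  (forall a, 0 <= F a) -> {homo cube_sum F : N M / (N <= M)%N >-> N <= M}.
Proof.
move=> F0 N M NM; rewrite /cube_sum.
pose w (a : {ffun 'I_n -> 'I_N}) : {ffun 'I_n -> 'I_M} :=
  [ffun i => widen_ord NM (a i)].
have winj : {in [set: {ffun 'I_n -> 'I_N}]%SET &, injective w}.
  move=> a b _ _ /ffunP ab; apply/ffunP => i; have := ab i; rewrite !ffunE.
  by move=> /(congr1 val)/= /val_inj.
rewrite [leRHS](bigID (mem (w @: [set: {ffun 'I_n -> 'I_N}])%SET))/=.
rewrite (big_imset _ winj)/=.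
under [X in _ <= X + _]eq_bigl do rewrite finset.in_setT.
have -> : \sum_(a : {ffun 'I_n -> 'I_N}) F [ffun i => val (w a i)] =
    \sum_(a : {ffun 'I_n -> 'I_N}) F [ffun i => val (a i)].
  by apply: eq_bigr => a _; congr F; apply/ffunP => i; rewrite !ffunE.
by rewrite lerDl sumr_ge0.
Qed.

Lemma cvgn_cube_sum_le n (F G : {ffun 'I_n -> nat} -> R) :
  (forall a, 0 <= F a) -> (forall a, F a <= G a) ->
  cvgn (cube_sum G) -> cvgn (cube_sum F).
Proof.
move=> F0 FG cG; apply: nondecreasing_is_cvgn.
  exact: cube_sum_nondecreasing.
exists (limn (cube_sum G)) => _ [N _ <-].
apply: le_trans (nondecreasing_cvgn_le _ cG N).
  by apply: ler_sum => a _.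
by apply: cube_sum_nondecreasing => a; exact: le_trans (FG a).
Qed.

Lemma cube_sumD n (F G : {ffun 'I_n -> nat} -> R) :
  cube_sum (fun a => F a + G a) = cube_sum F + cube_sum G.
Proof. by apply/funext => N; rewrite /cube_sum big_split. Qed.

Lemma analytic_atD n (f g : 'rV[R]_n -> R) p :
  analytic_at f p -> analytic_at g p -> analytic_at (fun x => f x + g x) p.
Proof.
move=> [c [r [r0 fP]]] [d [s [s0 gP]]].
exists (fun a => c a + d a), (Num.min r s); split=> [|h].
  by rewrite lt_min r0.
rewrite lt_min => /andP[/fP[fa fh] /gP[ga gh]].
have E : monomial_term (fun a => c a + d a) h =
    (fun a => monomial_term c h a + monomial_term d h a).
  by apply/funext => a; rewrite /monomial_term mulrDl.
split; last by rewrite E cube_sumD; exact: cvgD.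
apply: (@cvgn_cube_sum_le _ _
    (fun a => `|monomial_term c h a| + `|monomial_term d h a|)).
- by move=> a.
- by move=> a; rewrite E; exact: ler_normD.
- by rewrite cube_sumD; exact: is_cvgD.
Qed.

Lemma analytic_atZ n (f : 'rV[R]_n -> R) k p :
  analytic_at f p -> analytic_at (fun x => k * f x) p.
Proof.
move=> [c [r [r0 fP]]]; exists (fun a => k * c a), r; split=> // h /fP[fa fh].
have E : monomial_term (fun a => k * c a) h =
    (fun a => k * monomial_term c h a).
  by apply/funext => a; rewrite /monomial_term mulrA.
have cubeZ l F : cube_sum (fun a => l * F a) = l *: (cube_sum F : R^nat).
  by apply/funext => N; rewrite /cube_sum -mulr_sumr.
split; last by rewrite E cubeZ; exact: cvgZr.
rewrite E; under eq_fun do rewrite normrM.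
by rewrite cubeZ; exact: is_cvgZr.
Qed.

Lemma analytic_at_near n (f g : 'rV[R]_n -> R) p :
  (\near p, f p = g p) -> analytic_at g p -> analytic_at f p.
Proof.
move=> /nbhs_ballP[e e0 fg] [c [r [r0 gP]]].
exists c, (Num.min e r); split=> [|h]; first by rewrite lt_min r0 andbT.
rewrite lt_min => /andP[he /gP[? ?]]; split=> //.
by rewrite fg// -ball_normE/= opprD addNKr normrN.
Qed.

Lemma analytic_at_mul2 (f g : R -> R) p : entire f -> entire g ->
  analytic_at (fun x : 'rV[R]_2 => f (x 0 0) * g (x 0 1)) p.
Proof.
move=> ef eg.
have -> : (fun x : 'rV[R]_2 => f (x 0 0) * g (x 0 1)) =
    (fun x => \prod_(i < 2) (if i == 0 then f else g) (x 0 i)).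
  apply/funext => x; rewrite !big_ord_recl big_ord0 /= mulr1.
  by congr (f (x _ _) * g (x _ _)); exact: val_inj.
by apply: (@analytic_at_prod _ (fun i : 'I_2 => if i == 0 then f else g)) => i;
  case: ifP.
Qed.

Lemma analytic_at_snd (g : R -> R) p : entire g ->
  analytic_at (fun x : 'rV[R]_2 => g (x 0 1)) p.
Proof.
move=> /(analytic_at_mul2 p entire_one).
by congr analytic_at; apply/funext => x; rewrite mul1r.
Qed.

Lemma analytic_at_crd n (j : 'I_n) p : analytic_at
  (fun x : 'rV[R]_n => x 0 j) p.
Proof.
have -> : (fun x : 'rV[R]_n => x 0 j) =
    (fun x => \prod_(i < n) (if i == j then (fun y => 0 + 1 * y) else fun=> 1)
      (x 0 i)).
  apply/funext => x; rewrite (bigD1 j)//= eqxx add0r mul1r big1 ?mulr1// => i.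
  by move=> /negPf->.
apply: (@analytic_at_prod _
  (fun i : 'I_n => if i == j then (fun y => 0 + 1 * y) else fun=> 1)) => i.
by case: ifP => _; [exact: entire_affine|exact: entire_one].
Qed.

Lemma analytic_on_local n k (U : set 'rV[R]_n) (f g : 'rV[R]_n -> 'rV[R]_k) :
  open U -> (forall x, U x -> f x = g x) -> analytic_on U g -> analytic_on U f.
Proof.
move=> oU fg ag p Up j; apply: analytic_at_near (ag p Up j).
by near=> x; rewrite fg//; near: x; exact: open_nbhs_nbhs.
Unshelve. all: by end_near. Qed.

Lemma analytic_on_id n (U : set 'rV[R]_n) : open U -> analytic_on U id.
Proof. by move=> _ p _ j; exact: analytic_at_crd. Qed.

End AnalyticCalculus.

(** * Disjoint copies of an open set as a manifold *)

Section Sheets.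
Context {R : realType} (N n : nat) (O : set 'rV[R]_n).
Hypothesis openO : open O.

(** N disjoint copies of O, as a subspace of the product of a discrete space
    and R^n.  A regular map on this manifold is a family of N regular maps on O,
    and its range is the union of their ranges. *)
Definition sheets : set (nat * 'rV[R]_n) := [set p | (p.1 < N)%N /\ O p.2].

Definition sheet_of (p : sheets) : nat := (set_val p).1.
Definition sheet_point (p : sheets) : 'rV[R]_n := (set_val p).2.

Lemma sheetsP (p : sheets) : (sheet_of p < N)%N /\ O (sheet_point p).
Proof. by case: p => p pP; exact: set_mem pP. Qed.

Lemma set_val_continuous : continuous (set_val : sheets -> nat * 'rV[R]_n).
Proof. exact: initial_continuous. Qed.

Lemma sheet_of_continuous : continuous sheet_of.
Proof.
by move=> p; apply: continuous_comp; [exact: set_val_continuous|exact: cvg_fst].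
Qed.

Lemma sheet_point_continuous : continuous sheet_point.
Proof.
by move=> p; apply: continuous_comp; [exact: set_val_continuous|exact: cvg_snd].
Qed.

Lemma sheets_eq (p q : sheets) :
  sheet_of p = sheet_of q -> sheet_point p = sheet_point q -> p = q.
Proof.
case: p q => [[i x] pP] [[j y] qP]; rewrite /sheet_of /sheet_point !set_valE/=.
by move=> ij xy; apply: val_inj; rewrite /= ij xy.
Qed.

(** Two distinct points differ in their index or in their position, and both
    are continuous maps to Hausdorff spaces. *)
Lemma sheets_hausdorff : hausdorff_space sheets.
Proof.
move=> p q pq.
have H (T : topologicalType) (f : sheets -> T) : hausdorff_space T ->
    continuous f -> f p = f q.
  move=> hT cf; apply: hT => A B fpA fqB.
  by have [x [/= fA fB]] := pq _ _ (cf p A fpA) (cf q B fqB); exists (f x).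
apply: sheets_eq; last exact: H (@norm_hausdorff _ _) sheet_point_continuous.
apply: H sheet_of_continuous => i j ij.
by have [_ [-> ->]] := ij [set i] [set j] (discrete_set1 _) (discrete_set1 _).
Qed.

Lemma sheets_nbhs (p : sheets) (A : set sheets) :
  nbhs p A -> exists2 e, 0 < e & forall r, sheet_of r = sheet_of p ->
    ball (sheet_point p) e (sheet_point r) -> A r.
Proof.
move=> [_ [[W oW <-] Wp WA]].
have [[C D] /= [Ci Dx] CDW] : nbhs (set_val p) W by exact: open_nbhs_nbhs.
have {Dx} /nbhs_ballP[e /= e0 eD] : nbhs (sheet_point p) D by [].
exists e => // r ri pr; apply: WA; apply: CDW; split => /=; last exact: eD.
by rewrite -/(sheet_of r) ri; exact: nbhs_singleton Ci.
Qed.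

(** The balls with rational centre and radius 1 / (k + 1) in each copy. *)
Lemma sheets_second_countable : @second_countable sheets.
Proof.
pose b (s : nat * 'rV[rat]_n * nat) : set sheets :=
  [set p | sheet_of p = s.1.1 /\
  ball (map_mx ratr s.1.2 : 'rV[R]_n) (s.2.+1%:R^-1) (sheet_point p)].
exists (range b).
  have : countable [set: nat * 'rV[rat]_n * nat] by exact: countableP.
  by apply: sub_countable; exact: card_image_le.
split.
  move=> _ [[[i x] k] _ <-]; apply: openI.
    by have /continuousP/(_ _ (discrete_open [set i])) := sheet_of_continuous.
  by have /continuousP/(_ _ (ball_open _ _)) := sheet_point_continuous; apply.
move=> p A /sheets_nbhs[e e0 eA].
(* Two radii 1 / (k + 1) add up to less than e. *)
pose k := Num.truncn (2 / e).
have ke : 2 * k.+1%:R^-1 < e.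
  have := truncnS_gt (2 / e); rewrite -/k => ek.
  by rewrite ltr_pdivrMr// mulrC -ltr_pdivrMr.
have k0 : 0 < k.+1%:R^-1 :> R by rewrite invr_gt0.
have [q qP] : exists q : 'rV[rat]_n,
    ball (map_mx ratr q : 'rV[R]_n) k.+1%:R^-1 (sheet_point p).
  have /choice[q qP] : forall i : 'I_n, exists q : rat,
      `|ratr q - sheet_point p 0 i| < k.+1%:R^-1.
    move=> i; have [q] := @dense_rat R _
      (ex_intro _ _ (ballxx (sheet_point p 0 i) k0)) (ball_open _ _).
    by move=> [qb [s _ sq]]; exists s; rewrite sq distrC; exact: qb.
  exists (\row_i q i); split => // i j; rewrite !mxE ord1 -ball_normE/=.
  exact: qP.
exists (b (sheet_of p, q, k)); first by split;
  [exists (sheet_of p, q, k)|split].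
move=> r [/= ri rq]; apply: eA => //.
apply: (@le_ball _ _ _ (k.+1%:R^-1 + k.+1%:R^-1)).
  by move: ke; set d := _^-1; lra.
by apply: ball_triangle rq; exact: ball_sym.
Qed.

Variable p0 : sheets.

(** The inverse of the chart of the i-th copy, made total: outside O, its value
    is the arbitrary point p0. *)
Definition sheet_inv (i : nat) (x : 'rV[R]_n) : sheets :=
  if pselect (sheets (i, x)) is left H then exist _ (i, x) (mem_set H) else p0.

Lemma sheet_invP i x : (i < N)%N -> O x ->
  sheet_of (sheet_inv i x) = i /\ sheet_point (sheet_inv i x) = x.
Proof.
by move=> iN Ox; rewrite /sheet_inv; case: pselect => [H|[]//]; split.
Qed.

Lemma sheet_invK p : sheet_inv (sheet_of p) (sheet_point p) = p.
Proof.
have [iN Op] := sheetsP p; have [? ?] := sheet_invP iN Op; exact: sheets_eq.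
Qed.

Definition sheet_dom i : set sheets := [set p | sheet_of p = i].

Lemma sheet_dom_open i : open (sheet_dom i).
Proof.
by have /continuousP/(_ _ (discrete_open [set i])) := sheet_of_continuous.
Qed.

Lemma sheet_cod (i : 'I_N) : sheet_point @` sheet_dom i = O.
Proof.
apply/seteqP; split=> [_ [p _ <-]|x Ox]; first exact: (sheetsP p).2.
by have [? ?] := sheet_invP (ltn_ord i) Ox; exists (sheet_inv i x).
Qed.

Lemma sheet_cod_open (i : 'I_N) : open (sheet_point @` sheet_dom i).
Proof. by rewrite sheet_cod. Qed.

Lemma sheet_mapK (i : 'I_N) p : sheet_dom i p ->
  sheet_inv i (sheet_point p) = p.
Proof. by move=> <-; exact: sheet_invK. Qed.

Lemma sheet_inv_continuous (i : 'I_N) x : O x ->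
  {for x, continuous (sheet_inv i : 'rV[R]_n -> sheets)}.
Proof.
move=> Ox A [_ [[W oW <-] Wx WA]].
have [ix xx] := sheet_invP (ltn_ord i) Ox.
have nW : nbhs (nat_of_ord i, x) W.
  apply: open_nbhs_nbhs; split => //; move: Wx; rewrite /preimage/=.
  by rewrite [set_val _]surjective_pairing -/(sheet_of _) -/(sheet_point _) ix
    xx.
have : \forall y \near x, W (nat_of_ord i, y).
  by apply: (cvg_pair (cvg_cst (nat_of_ord i)) (cvg_id (F := nbhs x))).
move=> Wn; rewrite /= nbhs_simpl/=; near=> y.
apply: WA; rewrite /preimage/=.
have Oy : O y by near: y; exact: open_nbhs_nbhs.
have [iy yy] := sheet_invP (ltn_ord i) Oy.
rewrite [set_val _]surjective_pairing -/(sheet_of _) -/(sheet_point _) iy yy.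
by near: y.
Unshelve. all: by end_near. Qed.

Lemma sheet_map_within (i : 'I_N) :
  {within sheet_dom i, continuous (sheet_point : sheets -> 'rV[R]_n)}.
Proof. exact: continuous_subspaceT sheet_point_continuous. Qed.

Lemma sheet_inv_within (i : 'I_N) :
  {within sheet_point @` sheet_dom i, continuous sheet_inv i}.
Proof.
rewrite sheet_cod continuous_open_subspace// => x /set_mem.
exact: sheet_inv_continuous.
Qed.

Definition sheet_chart (i : 'I_N) : chart sheets n :=
  Chart (@sheet_dom_open i) (@sheet_cod_open i) (@sheet_mapK i)
    (@sheet_map_within i) (@sheet_inv_within i).

Variable reg : @regularity R.
Hypothesis reg_local : forall n k (U : set 'rV[R]_n)
  (f g : 'rV[R]_n -> 'rV[R]_k),
  open U -> (forall x, U x -> f x = g x) -> @reg n k U g -> @reg n k U f.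
Hypothesis reg_id : forall n (U : set 'rV[R]_n), open U -> @reg n n U id.

Lemma sheets_cover p : exists2 c, range sheet_chart c & chart_dom c p.
Proof.
have [iN _] := sheetsP p.
by exists (sheet_chart (Ordinal iN)) => //; exists (Ordinal iN).
Qed.

(** Distinct copies are disjoint and each copy has one chart, so a transition
    map is an identity or has empty domain. *)
Lemma sheets_transition c d : range sheet_chart c -> range sheet_chart d ->
  @reg n n (chart_map c @` (chart_dom c `&` chart_dom d))
          (chart_map d \o chart_inv c).
Proof.
move=> [i _ <-] [j _ <-] /=.
have oS : open (sheet_point @` (sheet_dom i `&` sheet_dom j)).
  have [<-|ij] := eqVneq i j; first by rewrite setIid sheet_cod.
  rewrite (_ : _ `&` _ = set0) ?image_set0; first exact: open0.
  apply/seteqP; split => // p [/= pi pj]; move/eqP: ij; apply.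
  by apply: val_inj; rewrite /= -pi -pj.
apply: reg_local (reg_id oS) => // _ [p [pi _] <-] /=.
by rewrite sheet_mapK.
Qed.

Definition sheets_manifold : manifold reg n :=
  Manifold sheets_hausdorff sheets_second_countable sheets_cover
    sheets_transition.

Lemma sheets_immersion k (S : set 'rV[R]_k)
  (phi : nat -> 'rV[R]_n -> 'rV[R]_k) :
  (forall i x, (i < N)%N -> O x -> S (phi i x)) ->
  (forall i, (i < N)%N -> @reg n k O (phi i)) ->
  (forall i x, (i < N)%N -> O x -> differentiable (phi i) x /\
     forall h, 'D_h (phi i) x = 0 -> h = 0) ->
  immersion S (fun p : sheets_manifold => phi (sheet_of p) (sheet_point p)).
Proof.
move=> Sphi rphi dphi; split=> [p|_ [i _ <-]]; first by have [] := sheetsP p;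
  exact: Sphi.
have -> : chart_cod (sheet_chart i) = O := sheet_cod i.
have E x : O x -> phi (sheet_of (sheet_inv i x)) (sheet_point (sheet_inv i x))
    = phi i x.
  by move=> Ox; have [-> ->] := sheet_invP (ltn_ord i) Ox.
split; first exact: reg_local (rphi i (ltn_ord i)).
move=> x Ox; have [dx ix] := dphi i x (ltn_ord i) Ox.
have En : \near x, phi (sheet_of (sheet_inv i x)) (sheet_point (sheet_inv i x))
    = phi i x.
  by near=> y; apply: E; near: y; exact: open_nbhs_nbhs.
move=> u v uv; apply/eqP; rewrite -subr_eq0; apply/eqP/ix.
rewrite -(near_eq_diff _ En dx).
by rewrite linearB; apply/eqP; rewrite subr_eq0; apply/eqP.
Unshelve. all: by end_near. Qed.

End Sheets.

(** The last hypothesis is the continuity of the inverse.  It also forces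
    injectivity: if p and q have the same image, then q lies in every
    neighbourhood of p, and the manifold is Hausdorff. *)
Lemma embedding_of_local_inverse (R : realType) (reg : @regularity R) n
    (M : manifold reg n) k (S : set 'rV[R]_k) (Phi : M -> 'rV[R]_k) :
  immersion S Phi -> continuous Phi ->
  (forall p A, nbhs p A -> exists2 V, nbhs (Phi p) V & Phi @^-1` V `<=` A) ->
  embedding S Phi.
Proof.
move=> iPhi cPhi invPhi; split => // [p q pq|U oU].
  apply: (@mfd_hausdorff _ _ _ M) => A B pA qB.
  have [V pV VA] := invPhi p A pA; exists q; split; last exact: nbhs_singleton.
  by apply: VA; rewrite /preimage/= -pq; exact: nbhs_singleton.
pose W := [set y | forall q, Phi q = y -> U q].
exists (interior W); first exact: open_interior.
apply/seteqP; split=> [_ [p Up <-]|y [/nbhs_singleton Wy [q _ qy]]]; last first.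
  by exists q => //; exact: Wy.
split; last by exists p.
have [V pV VU] := invPhi p U (open_nbhs_nbhs (conj oU Up)).
by apply: filterS pV => y Vy q qy; apply: VU; rewrite /preimage/= qy.
Qed.
(** * Row vectors and points of Minkowski space *)

Section RowVectors.
Context {R : realType}.

Lemma finite_discrete (T : topologicalType) (A D : set T) :
  hausdorff_space T -> finite_set D -> D `<=` A -> discrete_subset A D.
Proof.
move=> hT fD DA; split => // x Dx.
have nx : nbhs x (~` (D `\ x)).
  apply: open_nbhs_nbhs; split; last by move=> [_ /= []].
  apply: closed_openC; apply: (@accessible_finite_set_closed T).1.
    exact: hausdorff_accessible.
  exact: finite_setD.
split; first exact: mem_set.
exists (~` (D `\ x)) => //; apply/seteqP; split=> [y [yD Dy]|y ->].
  by apply/eqP/negPn/negP => /eqP yx; apply: yD.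
by split => // -[_ /=].
Qed.

Lemma cvg_row (T : Type) (F : set_system T) (FF : Filter F) n
    (f : T -> 'rV[R]_n) (l : 'rV[R]_n) :
  (forall i, (fun x => f x 0 i) @ F --> l 0 i) -> f @ F --> l.
Proof.
move=> fl A [P lP PA]; rewrite nbhs_simpl/=.
have := filter_forall FF (fun i : 'I_n => fl i _ (lP 0 i)).
by apply: filterS => x Px; apply: PA => i j; rewrite ord1; exact: Px.
Qed.

Lemma eq_crd (X Y : 'rV[R]_4) : crd_t X = crd_t Y -> crd_x X = crd_x Y ->
  crd_y X = crd_y Y ->
  crd_z X = crd_z Y -> X = Y.
Proof. by move=> ? ? ? ?; rewrite -[X]vec4_crd -[Y]vec4_crd; congr vec4. Qed.

Lemma vec4Z (k a b c d : R) : k *: vec4 a b c d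
  = vec4 (k * a) (k * b) (k * c) (k * d).
Proof.
have Z (X : 'rV[R]_4) : (crd_t (k *: X) = k * crd_t X) *
  (crd_x (k *: X) = k * crd_x X) *
    (crd_y (k *: X) = k * crd_y X) * (crd_z (k *: X) = k * crd_z X).
  by rewrite /crd_t /crd_x /crd_y /crd_z !mxE.
by apply: eq_crd; rewrite Z !crd_vec4.
Qed.

Lemma crd_continuous : [/\ continuous (@crd_t R), continuous (@crd_x R),
  continuous (@crd_y R) & continuous (@crd_z R)].
Proof. by split; exact: coord_continuous. Qed.

Lemma cvg_vec4 (T : Type) (F : set_system T) (FF : Filter F)
    (a b c d : T -> R) (a' b' c' d' : R) :
  a @ F --> a' -> b @ F --> b' -> c @ F --> c' -> d @ F --> d' ->
  (fun x => vec4 (a x) (b x) (c x) (d x)) @ F --> vec4 a' b' c' d'.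
Proof.
move=> fa fb fc fd; apply: cvg_row => -[[|[|[|[|//]]]] i4]; rewrite mxE /=;
  by under eq_fun do rewrite mxE.
Qed.

Lemma sqrt_expR (z : R) : Num.sqrt (expR z) = expR (z / 2).
Proof.
rewrite -[in LHS](_ : expR (z / 2) ^+ 2 = expR z).
  by rewrite sqrtr_sqr gtr0_norm// expR_gt0.
by rewrite expr2 -expRD; congr expR; field.
Qed.

End RowVectors.

(** * The hypotrochoid and the catenoid in polar coordinates *)

Section Trig.
Context {R : realType}.
Implicit Types (m : nat) (t : R).

Lemma polar_angle (a b : R) : a ^+ 2 + b ^+ 2 = 1 ->
  exists2 t, 0 <= t < 2 * pi & cos t = a /\ sin t = b.
Proof.
move=> ab.
have a1 : -1 <= a <= 1 by apply/andP; split; nra.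
have ca : cos (acos a) = a by apply: acosK; rewrite in_itv.
have sa : sin (acos a) = `|b|.
  by rewrite sin_acos// -sqrtr_sqr; congr Num.sqrt; lra.
have a0 := acos_ge0 a1; have api := acos_lepi a1; have pi0 := pi_gt0 R.
have [b0|b0] := lerP 0 b.
  by exists (acos a); [lra|rewrite ca sa ger0_norm].
exists (2 * pi - acos a).
  suff an0 : 0 < acos a by lra.
  rewrite lt_def a0 andbT; apply: contraTneq b0 => az; move: sa.
  by rewrite az sin0 => /esym/normr0_eq0 ->; rewrite ltxx.
rewrite mulr_natl addrC; split.
  by rewrite cosD2pi cosN.
by rewrite sinD2pi sinN sa ltr0_norm// opprK.
Qed.

Lemma cos_sin_natmul m t u : cos t = cos u -> sin t = sin u ->
  cos (m%:R * t) = cos (m%:R * u) /\ sin (m%:R * t) = sin (m%:R * u).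
Proof.
move=> ctu stu; elim: m => [|m [IHc IHs]]; first by rewrite !mul0r.
by rewrite -!natr1 !mulrDl !mul1r !cosD !sinD IHc IHs ctu stu.
Qed.

Lemma angle_reduction t :
  exists2 u, 0 <= u < 2 * pi & cos u = cos t /\ sin u = sin t.
Proof. exact: polar_angle (cos2Dsin2 t). Qed.

Lemma cos_natmul_eq0 m t : 0 <= t < 2 * pi -> cos (m%:R * t) = 0 ->
  exists2 k, (k < 2 * m)%N & m%:R * t = (2 * k%:R + 1) * pi / 2.
Proof.
move=> /andP[t0 t2] ct; have pi0 := pi_gt0 R.
have mt0 : 0 <= m%:R * t by rewrite mulr_ge0.
pose k := Num.truncn (m%:R * t / pi).
have /andP[k1 k2] : k%:R <= m%:R * t / pi < k.+1%:R by apply: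
  Num.Theory.truncn_itv; rewrite divr_ge0// ltW.
move: k1 k2; rewrite ler_pdivlMr// ltr_pdivrMr// -natr1 => k1 k2.
have cy : cos (m%:R * t - k%:R * pi) = 0.
  have := alternatingn (@cosDpi R) k (m%:R * t - k%:R * pi).
  rewrite -[pi *+ k]mulr_natl subrK ct => /esym/eqP.
  by rewrite mulf_eq0 signr_eq0 => /eqP.
have : m%:R * t - k%:R * pi = pi / 2.
  by apply: cos_inj; rewrite ?cy ?cos_pihalf// in_itv/=; lra.
move=> mtk; exists k; last by lra.
have mt2 : m%:R * t <= m%:R * (2 * pi) by rewrite ler_wpM2l// ltW.
rewrite -(ltr_nat R) natrM -(ltr_pM2r pi0); lra.
Qed.

End Trig.

Section Gamma.
Context {R : realType} (m : nat).
Hypothesis m_ge2 : (2 <= m)%N.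
Implicit Type t : R.

(** The right-hand side of the equation of CII is (amp cos (m theta))^2. *)
Definition amp : R := (m%:R ^+ 2 - 1) / (2 * m%:R).
(** The curve is expanded in the angles m theta and theta: in this form its norm
    and its behaviour under theta -> theta + pi can be computed directly. *)
Definition gamma_x t : R :=
  (m%:R ^+ 2 + 1) / (2 * m%:R) * cos (m%:R * t) * cos t
  + sin (m%:R * t) * sin t.
Definition gamma_y t : R :=
  (m%:R ^+ 2 + 1) / (2 * m%:R) * cos (m%:R * t) * sin t
  - sin (m%:R * t) * cos t.

Lemma m_neq0 : m%:R != 0 :> R.
Proof. by rewrite pnatr_eq0 -lt0n (leq_trans _ m_ge2). Qed.

Lemma m_geR : 2 <= m%:R :> R.
Proof. by rewrite ler_nat. Qed.

Lemma amp_gt0 : 0 < amp.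
Proof. by have := m_geR; rewrite /amp => m2; apply: divr_gt0; nra. Qed.

Lemma gammaE t : gamma m t = Complex (gamma_x t) (gamma_y t).
Proof.
rewrite /gamma /cis /gamma_x /gamma_y mulNr cosN sinN.
rewrite [(m%:R + 1) * t]mulrDl [(m%:R - 1) * t]mulrDl mul1r mulN1r.
rewrite cosD sinD cosB sinB.
have m0 := m_neq0.
by apply/eqP; rewrite eq_complex /=; apply/andP; split; apply/eqP; field.
Qed.

(** This identity is what places the points over the curve on de Sitter
    space. *)
Lemma gamma_norm t : gamma_x t ^+ 2 + gamma_y t ^+ 2 = 1
  + amp ^+ 2 * cos (m%:R * t) ^+ 2.
Proof.
rewrite /gamma_x /gamma_y /amp.
have := cos2Dsin2 t; have := cos2Dsin2 (m%:R * t).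
set C := cos (_ * _); set S := sin (_ * _); set c := cos t;
  set s := sin t => e1 e2.
have m0 := m_neq0.
set a := (_ + 1) / _.
have -> : (a * C * c + S * s) ^+ 2 + (a * C * s - S * c) ^+ 2 =
    (a ^+ 2 * C ^+ 2 + S ^+ 2) * (c ^+ 2 + s ^+ 2) by ring.
have -> : S ^+ 2 = 1 - C ^+ 2 by lra.
by rewrite e2 /a; field.
Qed.

Lemma gamma_eq t u : cos t = cos u -> sin t = sin u ->
  [/\ gamma_x t = gamma_x u, gamma_y t = gamma_y u &
      cos (m%:R * t) = cos (m%:R * u)].
Proof.
move=> c s; have [C S] := cos_sin_natmul m c s.
by rewrite /gamma_x /gamma_y c s C S.
Qed.

Lemma complex_natr n : n%:R = Complex (n%:R : R) 0.
Proof. by rewrite -[RHS]/((n%:R : R)%:C)%C rmorph_nat. Qed.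

Lemma cis_pow (r t : R) n :
  Complex (r * cos t) (r * sin t) ^+ n = Complex (r ^+ n * cos (n%:R * t))
    (r ^+ n * sin (n%:R * t)).
Proof.
elim: n => [|n IHn]; first by rewrite !expr0 mul0r cos0 sin0 mulr1 mulr0.
rewrite exprS IHn -natr1 mulrDl mul1r cosD sinD exprS.
by apply/eqP; rewrite eq_complex /=; apply/andP; split; apply/eqP; ring.
Qed.

Lemma norm_cis (r t : R) : 0 < r ->
  `|Complex (r * cos t) (r * sin t)| = Complex r 0.
Proof.
move=> r0; rewrite normc_def /=; congr Complex.
by rewrite !exprMn -mulrDr cos2Dsin2 mulr1 sqrtr_sqr gtr0_norm.
Qed.

(** The scalar in front of the matrix of the catenoid.  It contains square roots
    of complex numbers, but only its squared modulus enters F e3 F^*. *)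
Definition kappa (z : R[i]) : R[i] := sqrtC z ^- m.+1 / (2 * sqrtC (2 * m%:R)).

Lemma kappa_norm (r t : R) : 0 < r ->
  kappa (Complex (r * cos t) (r * sin t)) *
    (kappa (Complex (r * cos t) (r * sin t)))^*
  = Complex ((r ^+ m.+1 * (8 * m%:R))^-1) 0.
Proof.
move=> r0; set z := Complex _ _.
have nz : `|z| = Complex r 0 := norm_cis t r0.
have nS : `|sqrtC z| ^+ 2 = Complex r 0 by rewrite -normrX sqrtCK nz.
have nM : `|sqrtC (2 * m%:R)| ^+ 2 = Complex (2 * m%:R) 0 :> R[i].
  rewrite -normrX sqrtCK -natrM ger0_norm ?ler0n// complex_natr.
  by rewrite natrM.
rewrite -normCK /kappa normrM !normfV normrX normrM !exprMn !exprVn.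
rewrite exprAC nS exprMn nM (ger0_norm (ler0n _ 2)).
have -> : Complex r 0 ^+ m.+1 = Complex (r ^+ m.+1) 0.
  by rewrite -[Complex r 0]/(r%:C)%C -rmorphXn.
rewrite (complex_natr 2).
have -> : Complex (2 : R) 0 ^+ 2 * Complex (2 * m%:R) 0 = Complex (8 * m%:R) 0.
  by rewrite -!/((_)%:C)%C -rmorphXn -rmorphM; congr (_%:C)%C; ring.
by rewrite -invfM -[RHS]/((_^-1)%:C)%C fmorphV rmorphM.
Qed.

(** Each entry of F e3 F^* is the squared modulus of the scalar factor times a
    polynomial in z, z^m and their conjugates; the powers of r cancel. *)
Lemma fII_polar (r t : R) : 0 < r ->
  fII m (Complex (r * cos t) (r * sin t)) =
  vec4 (- (amp / 2 * (r + r^-1) * cos (m%:R * t))) (- gamma_x t) (- gamma_y t)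
       (- (amp / 2 * (r - r^-1) * cos (m%:R * t))).
Proof.
move=> r0; rewrite /fII.
set z := Complex _ _.
set F := FII m z *m e3 *m adjoint (FII m z).
set k := (r ^+ m.+1 * (8 * m%:R))^-1.
have FE i j : F i j = Complex k 0 * (let G :=
  mx2 (z * ((1 - m%:R) * z ^+ m + m%:R + 1))
  (z * ((m%:R - 1) * z ^+ m + m%:R + 1))
      (- (m%:R + 1) * z ^+ m + m%:R - 1) ((m%:R + 1) * z ^+ m + m%:R - 1) in
   G i 0 * (G j 0)^* - G i 1 * (G j 1)^*).
  rewrite /F /FII -/(kappa z); set G := mx2 _ _ _ _ => /=.
  rewrite -(kappa_norm t r0) -/z.
  rewrite !mxE !big_ord_recl !big_ord0 !mxE /= !big_ord_recl !big_ord0 !mxE/=.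
  by rewrite !rmorphM /=; ring.
have [Z ZE] : {Z | z ^+ m = Z} by exists (z ^+ m).
have mC : (m%:R)^* = m%:R :> R[i] by rewrite rmorph_nat.
have F00 : F 0 0 = Complex k 0 * (z * z^* *
  (- 2 * (m%:R ^+ 2 - 1) * (Z + Z^*))).
  by rewrite FE /= !mxE /= ZE !(rmorphM, rmorphD, rmorphB, rmorphN,
    rmorph_nat, rmorph1) /=; ring.
have F11 : F 1 1 = Complex k 0 * (- 2 * (m%:R ^+ 2 - 1) * (Z + Z^*)).
  by rewrite FE /= !mxE /= ZE !(rmorphM, rmorphD, rmorphB, rmorphN,
    rmorph_nat, rmorph1) /=; ring.
have F01 : F 0 1 = Complex k 0 *
    (- 2 * (z * ((m%:R - 1) ^+ 2 * Z + (m%:R + 1) ^+ 2 * Z^*))).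
  by rewrite FE /= !mxE /= ZE !(rmorphM, rmorphD, rmorphB, rmorphN,
    rmorph_nat, rmorph1) /=; ring.
pose C := cos (m%:R * t); pose S := sin (m%:R * t); pose rho := r ^+ m.
have {}ZE : Z = Complex (rho * C) (rho * S) by rewrite -ZE; exact: cis_pow.
have ZJ : Z^* = Complex (rho * C) (- (rho * S)) by rewrite ZE.
have zz : z * z^* = Complex (r ^+ 2) 0.
  by rewrite -normCK norm_cis// -[Complex r 0]/(r%:C)%C -rmorphXn.
have rho0 : rho != 0 by rewrite expf_neq0// gt_eqF.
have r0' : r != 0 by rewrite gt_eqF.
have kE : k = (r * rho * (8 * m%:R))^-1 by rewrite /k exprS.
have m0 := m_neq0.
rewrite /unherm -/F F00 F11 F01 zz ZJ ZE !complex_natr /z.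
have c1 : 1 = Complex 1 0 :> R[i] by [].
have cM (a b c d : R) :
  Complex a b * Complex c d = Complex (a * c - b * d) (a * d + b * c) by [].
have cD (a b c d : R) : Complex a b + Complex c d
  = Complex (a + c) (b + d) by [].
have cN (a b : R) : - Complex a b = Complex (- a) (- b) by [].
rewrite !expr2 c1 !(cM, cD, cN) /= kE /amp /gamma_x /gamma_y -/C -/S.
by congr vec4; field; rewrite ?r0' ?rho0 ?m0.
Qed.

End Gamma.

(** * The surface in light-cone coordinates *)

Section Catenoid.
Context {R : realType} (m : nat).
Hypothesis m_ge2 : (2 <= m)%N.
Implicit Types (t u v : R) (X : 'rV[R]_4).

(** The point over the angle t whose first and last coordinates have sum u and
    difference v.  In these light-cone coordinates the equation of CII is
    u v = amp^2 cos^2 (m t). *)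
Definition lightpt u v t : 'rV[R]_4 :=
  vec4 ((u + v) / 2) (- gamma_x m t) (- gamma_y m t) ((u - v) / 2).

Lemma CIIP X : CII R m X <-> exists t, [/\ crd_x X = - gamma_x m t,
  crd_y X = - gamma_y m t &
  crd_t X ^+ 2 - crd_z X ^+ 2 = amp m ^+ 2 * cos (m%:R * t) ^+ 2].
Proof.
have aE : amp m ^+ 2 = (m%:R ^+ 2 - 1) ^+ 2 / (2 * m%:R) ^+ 2 :> R.
  by rewrite /amp exprMn exprVn.
split=> [[t [_ + XE]]|[t [xE yE tz]]].
  by rewrite gammaE// => -[-> ->]; exists t; rewrite aE.
have [u u2 [cu su]] := angle_reduction t.
have [gx gy C] := gamma_eq m cu su.
exists u; split => //; first by rewrite gammaE// xE yE gx gy.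
by rewrite tz aE C.
Qed.

Lemma CII_lightpt u v t : u * v = amp m ^+ 2 * cos (m%:R * t) ^+ 2 ->
  CII R m (lightpt u v t).
Proof.
move=> uv; apply/CIIP; exists t; rewrite /lightpt !crd_vec4; split => //.
by rewrite -uv; field.
Qed.

Lemma CII_ex_lightpt X : CII R m X -> exists u v t,
  u * v = amp m ^+ 2 * cos (m%:R * t) ^+ 2 /\ X = lightpt u v t.
Proof.
move=> /CIIP[t [xE yE tz]].
exists (crd_t X + crd_z X), (crd_t X - crd_z X), t; split;
  first by rewrite -tz; ring.
by apply: eq_crd; rewrite /lightpt !crd_vec4 //; field.
Qed.

(** By [gamma_norm], over the curve the equation of CII and the equation of de
    Sitter space are the same. *)
Lemma CII_dS3 X : CII R m X <-> dS3 R X /\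
  exists t, crd_x X = - gamma_x m t /\ crd_y X = - gamma_y m t.
Proof.
rewrite CIIP /dS3/= /lorentz; split=> [[t [xE yE tz]]|[XX [t [xE yE]]]].
  by split; [rewrite xE yE; have := gamma_norm m_ge2 t; nra|exists t].
exists t; split => //; have := gamma_norm m_ge2 t.
by move: XX; rewrite xE yE; nra.
Qed.

Lemma fII_imageP X : fII_image R m X <-> exists r t, 0 < r /\
  X = lightpt (- (amp m * r * cos (m%:R * t)))
    (- (amp m * r^-1 * cos (m%:R * t))) t.
Proof.
have E r t : 0 < r -> fII m (Complex (r * cos t) (r * sin t)) =
    lightpt (- (amp m * r * cos (m%:R * t)))
      (- (amp m * r^-1 * cos (m%:R * t))) t.
  by move=> r0; rewrite fII_polar// /lightpt; congr vec4; field; rewrite gt_eqF.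
split=> [[[a b] /= z0 <-]|[r [t [r0 ->]]]].
  have r0 : 0 < Num.sqrt (a ^+ 2 + b ^+ 2).
    rewrite sqrtr_gt0 lt_def addr_ge0 ?sqr_ge0// andbT.
    apply: contra z0; rewrite paddr_eq0 ?sqr_ge0// !sqrf_eq0 =>
      /andP[/eqP-> /eqP->].
    by [].
  have rr : Num.sqrt (a ^+ 2 + b ^+ 2) ^+ 2 = a ^+ 2 + b ^+ 2.
    by rewrite sqr_sqrtr// addr_ge0 ?sqr_ge0.
  set r := Num.sqrt _ in r0 rr.
  have [|t _ [ct st]] := @polar_angle _ (a / r) (b / r).
    by rewrite !expr_div_n -mulrDl -rr divff// expf_neq0// gt_eqF.
  have -> : Complex a b = Complex (r * cos t) (r * sin t).
    by rewrite ct st ![r * _]mulrC !divfK// gt_eqF.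
  by exists r, t; split => //; exact: E.
exists (Complex (r * cos t) (r * sin t)); last exact: E.
apply/eqP => -[] /eqP; rewrite mulf_eq0 gt_eqF//= => /eqP c0 /eqP.
rewrite mulf_eq0 gt_eqF//= => /eqP s0.
by have := cos2Dsin2 t; rewrite c0 s0 expr0n/= addr0 => /eqP;
  rewrite eq_sym oner_eq0.
Qed.

Lemma fII_image_CII : fII_image R m `<=` CII R m.
Proof.
move=> X /fII_imageP[r [t [r0 ->]]]; apply: CII_lightpt.
by field; rewrite gt_eqF.
Qed.

(** The equation u = - amp r cos (m t) has a solution r > 0 exactly under the
    sign condition; then the product u v determines v. *)
Lemma fII_image_lightpt u v t : u * v = amp m ^+ 2 * cos (m%:R * t) ^+ 2 ->
  u * cos (m%:R * t) < 0 -> fII_image R m (lightpt u v t).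
Proof.
have a0 := amp_gt0 (R := R) m_ge2.
move=> uv uC; apply/fII_imageP.
have C0 : cos (m%:R * t) != 0 by apply: contraTneq uC => ->; rewrite mulr0 ltxx.
have u0 : u != 0 by apply: contraTneq uC => ->; rewrite mul0r ltxx.
exists (- u / (amp m * cos (m%:R * t))), t; split.
  rewrite (_ : _ / _ = - (u * cos (m%:R * t)) / (amp m * cos (m%:R * t) ^+ 2)).
    by rewrite divr_gt0 ?oppr_gt0// mulr_gt0// exprn_even_gt0.
  by field; rewrite C0 gt_eqF.
have vE : v = amp m ^+ 2 * cos (m%:R * t) ^+ 2 / u by rewrite -uv mulrC mulKf.
by congr lightpt; rewrite ?vE; field; rewrite ?C0 ?u0 ?oppr_eq0 ?u0 gt_eqF.
Qed.

Lemma half_odd_pi (k : nat) :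
  cos ((2 * k%:R + 1) * pi / 2) = 0 :> R /\
  sin ((2 * k%:R + 1) * pi / 2) = (-1) ^+ k :> R.
Proof.
have -> : (2 * k%:R + 1) * pi / 2 = pi / 2 + pi *+ k :> R.
  by rewrite -mulr_natl; field.
by rewrite (alternatingn (@cosDpi R)) (alternatingn (@sinDpi R)) cos_pihalf
  sin_pihalf mulr0 mulr1.
Qed.

Lemma cone_like_singularityP X : cone_like_singularities R m X <->
  exists t, cos (m%:R * t) = 0 /\ X = lightpt 0 0 t.
Proof.
have m0 : m%:R != 0 :> R := m_neq0 m_ge2.
have E k t : m%:R * t = (2 * k%:R + 1) * pi / 2 -> cos (m%:R * t) = 0 /\
    (-1) ^+ k *: vec4 0 (- sin t) (cos t) 0 = lightpt 0 0 t.
  move=> mt; have [c s] := half_odd_pi k; rewrite mt; split => //.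
  rewrite vec4Z /lightpt /gamma_x /gamma_y mt c s.
  by congr vec4; ring.
split=> [[k [_ /= ->]]|[t [ct ->]]].
  set t := _ / _; have mt : m%:R * t = (2 * k%:R + 1) * pi / 2.
    by rewrite /t; field.
  by exists t; exact: E.
have [u u2 [cu su]] := angle_reduction t.
have [gx gy C] := gamma_eq m cu su.
have [|k km mu] := @cos_natmul_eq0 _ m u u2; first by rewrite C.
exists k; split => //.
have uE : u = (2 * k%:R + 1) * pi / (2 * m%:R).
  by apply: (mulfI m0); rewrite mu; field.
rewrite /= -uE (E k u mu).2 /lightpt; congr vec4; by rewrite ?gx ?gy.
Qed.

(** For t = z = 0 the equation of CII says that cos (m theta) = 0. *)
Lemma cone_like_singularity_crd X : cone_like_singularities R m X <->
  [/\ CII R m X, crd_t X = 0 & crd_z X = 0].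
Proof.
rewrite cone_like_singularityP; split=> [[t [ct ->]]|[CX tX zX]].
  split; first by apply: CII_lightpt; rewrite ct expr0n/= !mulr0.
    by rewrite /lightpt !crd_vec4; ring.
  by rewrite /lightpt !crd_vec4; ring.
move: CX => /CIIP[t [xE yE]]; rewrite tX zX expr0n/= subrr => /esym/eqP.
rewrite mulf_eq0 !sqrf_eq0 gt_eqF ?amp_gt0//= => /eqP ct; exists t; split => //.
by apply: eq_crd; rewrite /lightpt !crd_vec4 // ?(addr0, subr0) mul0r.
Qed.

Lemma discrete_cone_like_singularities :
  discrete_subset (CII R m) (cone_like_singularities R m).
Proof.
apply: finite_discrete; first exact: norm_hausdorff.
  pose f (k : nat) : 'rV[R]_4 :=
    let alpha := (2 * k%:R + 1) * pi / (2 * m%:R) in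
    (-1) ^+ k *: vec4 0 (- sin alpha) (cos alpha) 0.
  apply: (@sub_finite_set _ _ (f @` `I_(2 * m))).
    by move=> X [k [km ->]]; exists k.
  exact/finite_image/finite_II.
by move=> X /cone_like_singularity_crd[].
Qed.

Lemma projection_CII : xy_projection @` CII R m = hypotrochoid R m.
Proof.
apply/seteqP; split=> [_ [X /CIIP[t [xE yE _]] <-]|_ [t _ <-]].
  by exists t => //; rewrite gammaE// /xy_projection xE yE.
exists (lightpt (amp m * cos (m%:R * t)) (amp m * cos (m%:R * t)) t).
  by apply: CII_lightpt; ring.
by rewrite /xy_projection /lightpt !crd_vec4 gammaE.
Qed.

(** On de Sitter space the section is t^2 - z^2 = a^2 + b^2 - 1, whichever
    angles lie over (a, b).  The right-hand side is (amp cos (m theta))^2, and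
    the conic degenerates only if it vanishes. *)
Lemma section_hyperbola (a b : R) : hypotrochoid R m (Complex a b) ->
  vertical_plane a b `&` cone_like_singularities R m = set0 ->
  is_hyperbola (vertical_section (CII R m) a b).
Proof.
move=> [t _]; rewrite gammaE// => -[aE bE] cone0.
pose k := a ^+ 2 + b ^+ 2 - 1.
have kE : k = amp m ^+ 2 * cos (m%:R * t) ^+ 2.
  by rewrite /k -aE -bE !sqrrN gamma_norm//; ring.
have k0 : k != 0.
  rewrite kE mulf_neq0// sqrf_eq0 ?(gt_eqF (amp_gt0 m_ge2))//.
  apply/eqP => ct; suff : set0 (lightpt 0 0 t) by [].
  rewrite -cone0; split; first by split; rewrite /lightpt !crd_vec4.
  by apply/cone_like_singularityP; exists t.
exists 1, 0, (-1), 0, 0, (- k); split.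
- apply/seteqP; split=> [_ [X [CX [Xa Xb]] <-]|[u v] /= uv].
    move/CII_dS3: CX => [+ _]; rewrite /dS3/= /lorentz Xa Xb /k; lra.
  exists (vec4 u a b v); last by rewrite !crd_vec4.
  split; last by split; rewrite !crd_vec4.
  apply/CII_dS3; split; first by rewrite /dS3/= /lorentz !crd_vec4; move: uv;
    rewrite /k; lra.
  by exists t; rewrite !crd_vec4.
- lra.
- by apply: contra k0 => /eqP e; apply/eqP; lra.
Qed.

End Catenoid.

(** * The closure of the catenoid *)

Section Closure.
Context {R : realType} (m : nat).
Hypothesis m_ge2 : (2 <= m)%N.
Implicit Types (t u v : R) (X : 'rV[R]_4).

Lemma cos_natmul_continuous : continuous (fun t : R => cos (m%:R * t)).
Proof.
move=> t; apply: continuous_comp; last exact: continuous_cos.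
exact: mulrl_continuous.
Qed.

Lemma sin_natmul_continuous : continuous (fun t : R => sin (m%:R * t)).
Proof.
move=> t; apply: continuous_comp; last exact: continuous_sin.
exact: mulrl_continuous.
Qed.

Lemma gamma_x_continuous : continuous (@gamma_x R m).
Proof.
move=> t; apply: cvgD; apply: cvgM.
- by apply: cvgMr; exact: cos_natmul_continuous.
- exact: continuous_cos.
- exact: sin_natmul_continuous.
- exact: continuous_sin.
Qed.

Lemma gamma_y_continuous : continuous (@gamma_y R m).
Proof.
move=> t; apply: cvgB; apply: cvgM.
- by apply: cvgMr; exact: cos_natmul_continuous.
- exact: continuous_sin.
- exact: sin_natmul_continuous.
- exact: continuous_cos.
Qed.

(** The angle over a point of CII need not be unique, so a closed condition on
    it is expressed through the points that admit some angle in Theta. *)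
Definition over_arc (Theta : set R) : set 'rV[R]_4 :=
  [set X | exists2 t, Theta t
    & crd_x X = - gamma_x m t /\ crd_y X = - gamma_y m t].

(** The corresponding part of the curve is compact, hence closed in the
    plane. *)
Lemma over_arc_closed Theta : closed Theta -> Theta `<=` `[0, 2 * pi] ->
  closed (over_arc Theta).
Proof.
move=> cT T2.
have [_ cx cy _] := @crd_continuous R.
pose c t : R * R := (- gamma_x m t, - gamma_y m t).
have cc : continuous c.
  move=> t; exact: (cvg_pair (cvgN (@gamma_x_continuous t))
    (cvgN (@gamma_y_continuous t))).
have kT : compact (c @` Theta).
  apply: continuous_compact; first exact: continuous_subspaceT.
  by apply: (subclosed_compact cT _ T2); exact: segment_compact.
have hT : closed (c @` Theta) by apply: compact_closed kT;
  exact: norm_hausdorff.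
have -> : over_arc Theta = (fun X => (crd_x X, crd_y X)) @^-1` (c @` Theta).
  apply/seteqP; split=> X [t Tt]; first by move=> [xE yE]; exists t => //;
    rewrite /c -xE -yE.
  by move=> [xE yE]; exists t.
by apply: closed_comp hT => X _; exact: (cvg_pair (cx X) (cy X)).
Qed.

Lemma dS3_closed : closed (dS3 R).
Proof.
have [ct cx cy cz] := @crd_continuous R.
apply: (@closed_comp _ _ (fun X : 'rV[R]_4 => lorentz X X) [set 1]);
  last exact: closed_eq.
move=> X _; exact: (cvgD (cvgD (cvgD (cvgN (cvgM (ct X) (ct X)))
  (cvgM (cx X) (cx X))) (cvgM (cy X) (cy X))) (cvgM (cz X) (cz X))).
Qed.

Lemma CII_closed : closed (CII R m).
Proof.
have -> : CII R m = dS3 R `&` over_arc `[0, 2 * pi].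
  apply/seteqP; split=> X.
    move=> CX; split; first by case/(CII_dS3 m_ge2): CX.
    case: CX => t [/andP[t0 t2] + _]; rewrite gammaE// => -[xE yE].
    by exists t => //=; rewrite in_itv/= t0 ltW.
  by move=> [SX [t _ E]]; apply/(CII_dS3 m_ge2); split => //; exists t.
apply: closedI; first exact: dS3_closed.
by apply: over_arc_closed; first exact: itv_closed.
Qed.

Lemma closure_image_CII : closure_dS3 (fII_image R m) `<=` CII R m.
Proof.
move=> X [IX _]; rewrite ((closure_id _).1 CII_closed).
exact: closure_subset (fII_image_CII m_ge2) _ IX.
Qed.

(** The reflection z -> - z exchanges the two light-cone coordinates.  The
    boolean records which of them is u, so that the two coordinates can be
    treated by one argument. *)
Definition swap_lightpt (b : bool) u v t : 'rV[R]_4 :=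
  if b then lightpt m v u t else lightpt m u v t.

Lemma fII_image_swap b u v t : u * v = amp m ^+ 2 * cos (m%:R * t) ^+ 2 ->
  u * cos (m%:R * t) < 0 -> fII_image R m (swap_lightpt b u v t).
Proof.
case: b => uv uC; last exact: fII_image_lightpt.
apply: fII_image_lightpt; rewrite // 1?mulrC//.
have a0 := amp_gt0 (R := R) m_ge2.
have C0 : cos (m%:R * t) != 0 by apply: contraTneq uC => ->; rewrite mulr0 ltxx.
rewrite -(nmulr_rgt0 _ uC).
rewrite (_ : u * cos (m%:R * t) * (cos (m%:R * t) * v) =
  u * v * cos (m%:R * t) ^+ 2); last by ring.
rewrite uv (_ : _ * cos (m%:R * t) ^+ 2 = (amp m * cos (m%:R * t) ^+ 2) ^+ 2);
  last by ring.
by rewrite exprn_even_gt0//= mulf_neq0 ?expf_neq0// gt_eqF.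
Qed.

Lemma cvg_lightpt (T : Type) (F : set_system T) (FF : Filter F)
    (a b c : T -> R) (u v t : R) :
  a @ F --> u -> b @ F --> v -> c @ F --> t ->
  (fun x => lightpt m (a x) (b x) (c x)) @ F --> lightpt m u v t.
Proof.
move=> fa fb fc; apply: cvg_vec4.
- by apply: cvgMl; exact: cvgD.
- by apply: cvgN; apply: continuous_cvg fc; exact: gamma_x_continuous.
- by apply: cvgN; apply: continuous_cvg fc; exact: gamma_y_continuous.
- by apply: cvgMl; exact: cvgB.
Qed.

(** Keep u fixed and let the angle tend to t from the side where
    u cos (m s) < 0.  The points lie on the catenoid, and their second
    coordinate amp^2 cos^2 (m s) / u tends to 0. *)
Lemma closure_light_line b u t : u != 0 -> cos (m%:R * t) = 0 ->
  closure (fII_image R m) (swap_lightpt b u 0 t).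
Proof.
move=> u0 ct A nA.
have m0 : 0 < m%:R :> R by rewrite ltr0n (leq_trans _ m_ge2).
pose P s := swap_lightpt b u (amp m ^+ 2 * cos (m%:R * s) ^+ 2 / u) s.
have Pt : P t = swap_lightpt b u 0 t.
  by rewrite /P ct expr0n/= mulr0 mul0r.
have cP : {for t, continuous P}.
  have cv : (fun s => amp m ^+ 2 * cos (m%:R * s) ^+ 2 / u) @ t -->
      amp m ^+ 2 * cos (m%:R * t) ^+ 2 / u.
    apply: cvgMl; apply: cvgMr.
    by apply: (cvgM (f := fun s => cos (m%:R * s))
      (g := fun s => cos (m%:R * s)));
      exact: cos_natmul_continuous.
  rewrite /continuous_at /P /swap_lightpt; case: b {Pt P nA};
    apply: cvg_lightpt => //; exact: cvg_cst.
have : \forall s \near t, A (P s) by apply: cP; rewrite Pt.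
move=> /nbhs_ballP[d /= d0 dA].
(* At the angle s = t + e w / m one has u cos (m s) = - w sin (e w), which is
   negative for e > 0 small. *)
pose w := u * sin (m%:R * t).
have sm : sin (m%:R * t) ^+ 2 = 1 by have := cos2Dsin2 (m%:R * t);
  rewrite ct expr0n/= add0r.
have w0 : w != 0.
  rewrite mulf_neq0//; apply: contraTneq (@oner_neq0 R) => s0.
  by rewrite -sm s0 expr0n eqxx.
pose e := Num.min (d * m%:R / 2) 1 / `|w|.
have w0' : 0 < `|w| by rewrite normr_gt0.
have ew0 : 0 < e * `|w|.
  by rewrite /e divfK ?gt_eqF// lt_min ltr01 andbT divr_gt0// mulr_gt0.
have ewd : e * `|w| < d * m%:R.
  rewrite /e divfK ?gt_eqF//; apply: (@le_lt_trans _ _ (d * m%:R / 2));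
    first by rewrite ge_min lexx.
  by rewrite ltr_pdivrMr// ltr_pMr ?ltr1n// mulr_gt0.
have ew1 : e * `|w| <= 1.
  by rewrite /e divfK ?gt_eqF// ge_min lexx orbT.
have e0 : 0 < e by rewrite -(pmulr_lgt0 _ w0').
pose s := t + e * w / m%:R.
have ms : m%:R * s = m%:R * t + e * w by rewrite /s mulrDr mulrC; field;
  rewrite gt_eqF.
exists (P s); split; last first.
  apply: dA; rewrite /ball/= /s opprD addNKr normrN normrM normfV
    [`|e * w|]normrM.
  by rewrite (gtr0_norm e0) (gtr0_norm m0) ltr_pdivrMr.
apply: fII_image_swap; first by field.
rewrite ms cosD ct mul0r sub0r mulrN mulrA -/w oppr_lt0.
have se : 0 < sin (e * `|w|).
  by apply: sin_gt0_pi; rewrite ew0 (le_lt_trans ew1)//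
    (lt_le_trans _ (pi_ge2 R)) ?ltr1n.
move: se; have [w1|w1] := ltrP 0 w; first by rewrite gtr0_norm// => ?;
  exact: mulr_gt0.
by rewrite ler0_norm// mulrN sinN oppr_gt0 => ?;
  rewrite nmulr_rgt0// lt_neqAle w0.
Qed.

Lemma closure_light_lines u v t : u * v = 0 -> cos (m%:R * t) = 0 ->
  closure (fII_image R m) (lightpt m u v t).
Proof.
move=> uv ct; have [u0|u0] := eqVneq u 0; last first.
  have v0 : v = 0 by apply/eqP; move/eqP: uv; rewrite mulf_eq0 (negPf u0).
  by rewrite v0; exact: (@closure_light_line false).
have [v0|v0] := eqVneq v 0; last by rewrite u0;
  exact: (@closure_light_line true).
apply: subset_closure; apply/(fII_imageP m_ge2); exists 1, t; split => //.
by rewrite ct u0 v0 !mulr0 !oppr0.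
Qed.

Lemma iota_lightpt u v t : iota_dS3 (lightpt m u v t) = lightpt m (- u) (- v) t.
Proof. by rewrite /iota_dS3 /lightpt !crd_vec4; congr vec4; field. Qed.

Lemma lightpt_dS3 u v t : u * v = amp m ^+ 2 * cos (m%:R * t) ^+ 2 ->
  dS3 R (lightpt m u v t).
Proof. by move=> /(CII_lightpt m_ge2)/(CII_dS3 m_ge2)[]. Qed.

(** On the surface u cos (m t) = 0 only if cos (m t) = 0, where the light-like
    lines are in the closure; a negative sign means a point of the catenoid. *)
Lemma CII_closure_or_iota X : CII R m X -> closure_dS3 (fII_image R m) X \/
  exists u v t, [/\ u * v = amp m ^+ 2 * cos (m%:R * t) ^+ 2,
    0 < u * cos (m%:R * t)
    & X = lightpt m u v t].
Proof.
move=> /(CII_ex_lightpt m_ge2)[u [v [t [uv XE]]]].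
have SX : dS3 R X by rewrite XE; exact: lightpt_dS3.
have [ct|ct] := eqVneq (cos (m%:R * t)) 0.
  left; split=> //; rewrite XE; apply: closure_light_lines => //.
  by rewrite uv ct expr0n/= mulr0.
have [uC|uC|/eqP] := ltrgt0P (u * cos (m%:R * t)).
- by right; exists u, v, t.
- by left; split => //; rewrite XE; apply: subset_closure;
    exact: fII_image_lightpt.
rewrite mulf_eq0 (negPf ct) orbF => /eqP u0; move/eqP: uv.
by rewrite u0 mul0r eq_sym mulf_eq0 !sqrf_eq0 (negPf ct) gt_eqF ?amp_gt0.
Qed.

(** For odd m each of cos t, sin t, cos (m t) and sin (m t) changes sign, and
    the curve is quadratic in them. *)
Lemma lightpt_Dpi u v t : odd m -> lightpt m u v (t + pi) = lightpt m u v t /\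
  cos (m%:R * (t + pi)) = - cos (m%:R * t).
Proof.
move=> om.
have E : m%:R * (t + pi) = m%:R * t + pi *+ m.
  by rewrite mulrDr [_ * pi]mulr_natl.
have C : cos (m%:R * (t + pi)) = - cos (m%:R * t).
  by rewrite E (alternatingn (@cosDpi R)) -signr_odd om mulN1r.
have S : sin (m%:R * (t + pi)) = - sin (m%:R * t).
  by rewrite E (alternatingn (@sinDpi R)) -signr_odd om mulN1r.
split => //; rewrite /lightpt /gamma_x /gamma_y C S cosDpi sinDpi.
by congr vec4; ring.
Qed.

Lemma CII_odd : odd m -> CII R m = closure_dS3 (fII_image R m).
Proof.
move=> om; apply/seteqP; split; last exact: closure_image_CII.
move=> X /CII_closure_or_iota[//|[u [v [t [uv uC XE]]]]].
split; last by rewrite XE; exact: lightpt_dS3.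
have [E C] := lightpt_Dpi u v t om.
rewrite XE -E; apply: subset_closure; apply: fII_image_lightpt => //.
  by rewrite C sqrrN.
by rewrite C mulrN oppr_lt0.
Qed.

Lemma iota_dS3K X : iota_dS3 (iota_dS3 X) = X.
Proof. by apply: eq_crd; rewrite /iota_dS3 !crd_vec4 ?opprK. Qed.

Lemma lorentz_iota X Y : lorentz (iota_dS3 X) (iota_dS3 Y) = lorentz X Y.
Proof. by rewrite /lorentz /iota_dS3 !crd_vec4; ring. Qed.

Lemma iota_CII X : CII R m X -> CII R m (iota_dS3 X).
Proof.
move=> /(CII_ex_lightpt m_ge2)[u [v [t [uv ->]]]]; rewrite iota_lightpt.
by apply: CII_lightpt => //; rewrite mulrNN.
Qed.

Lemma CII_iota : CII R m = closure_dS3 (fII_image R m)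
                  `|` iota_dS3 @` closure_dS3 (fII_image R m).
Proof.
apply/seteqP; split=> X.
  move=> /CII_closure_or_iota[?|[u [v [t [uv uC XE]]]]]; first by left.
  right; exists (iota_dS3 X); last exact: iota_dS3K.
  have uv' : - u * - v = amp m ^+ 2 * cos (m%:R * t) ^+ 2 by rewrite mulrNN.
  rewrite XE iota_lightpt; split; last exact: lightpt_dS3.
  apply: subset_closure; apply: fII_image_lightpt => //.
  by rewrite mulNr oppr_lt0.
by move=> [/closure_image_CII//|[Y /closure_image_CII CY <-]]; exact: iota_CII.
Qed.

(** The point over the angle 0 with t = amp and z = 0 is not in the closure.
    Every point of the catenoid has t <= 0 or lies over an angle with
    cos (m theta) <= 0, and this alternative passes to the closure.  But the
    norm of gamma_m is maximal at the angle 0, so an angle with the same value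
    of gamma_m and cos (m theta) <= 0 has cos (m theta) = - 1, and then
    cos theta = - 1, which is impossible for m even. *)
Lemma closure_image_even : ~~ odd m -> closure_dS3 (fII_image R m) `<` CII R m.
Proof.
move=> em; split; first exact: closure_image_CII.
have a0 := amp_gt0 (R := R) m_ge2.
have [ct _ _ _] := @crd_continuous R.
(* The catenoid lies in the closed set Z. *)
pose Theta := `[0, 2 * pi] `&` [set t : R | cos (m%:R * t) <= 0].
pose Z := [set X : 'rV[R]_4 | crd_t X <= 0] `|` over_arc Theta.
have cZ : closed Z.
  apply: closedU.
    apply: (@closed_comp _ _ (@crd_t R) [set x | x <= 0]);
      last exact: closed_le.
    by move=> ? _; exact: ct.
  apply: over_arc_closed; last exact: subIsetl.
  apply: closedI; first exact: itv_closed.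
  apply: (@closed_comp _ _ (fun t : R => cos (m%:R * t)) [set x | x <= 0]);
    last exact: closed_le.
  by move=> ? _; exact: cos_natmul_continuous.
have IZ : fII_image R m `<=` Z.
  move=> X /(fII_imageP m_ge2)[r [t [r0 ->]]].
  have [u /andP[u0 u2] [cu su]] := angle_reduction t.
  have [gx gy C] := gamma_eq m cu su.
  have [c0|c0] := lerP (cos (m%:R * t)) 0.
    right; exists u; first by split; rewrite /= ?in_itv/= ?u0 ?(ltW u2)// C.
    by rewrite /lightpt !crd_vec4 gx gy.
  left; rewrite /= /lightpt !crd_vec4 -opprD mulNr oppr_le0 divr_ge0// ltW//.
  by apply: addr_gt0; apply: mulr_gt0 => //; [exact: mulr_gt0|exact: divr_gt0].
have C0 : cos (m%:R * 0) = 1 :> R by rewrite mulr0 cos0.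
have S0 : sin (m%:R * 0) = 0 :> R by rewrite mulr0 sin0.
pose X0 := lightpt m (amp m) (amp m) (0 : R).
have CX0 : CII R m X0 by apply: CII_lightpt => //; rewrite C0; ring.
move=> /(_ X0 CX0)[IX0 _].
have := closure_subset IZ IX0; rewrite -((closure_id _).1 cZ) => -[].
  by rewrite /= /X0 /lightpt !crd_vec4; apply/negP;
    rewrite -ltNge divr_gt0// addr_gt0.
move=> [t [_ /= tC]]; rewrite /X0 /lightpt !crd_vec4 =>
  -[/oppr_inj xE /oppr_inj yE].
have := gamma_norm m_ge2 t; rewrite -xE -yE gamma_norm// C0 expr1n mulr1 =>
  /addrI.
rewrite -[LHS]mulr1 => /(mulfI (expf_neq0 2 (lt0r_neq0 a0))) c1.
have c1' : cos (m%:R * t) = -1 by nra.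
have s1 : sin (m%:R * t) = 0.
  by have := cos2Dsin2 (m%:R * t); rewrite c1' => s; nra.
have m0 : 0 < m%:R :> R by rewrite ltr0n (leq_trans _ m_ge2).
have k0 : (m%:R ^+ 2 + 1) / (2 * m%:R) != 0 :> R.
  by rewrite gt_eqF// divr_gt0// ?mulr_gt0// addr_gt0// exprn_gt0.
have ct1 : 1 = - cos t.
  by apply: (mulfI k0); move: xE; rewrite /gamma_x c1' s1 C0 S0 cos0 => xE; lra.
have ctp : cos t = cos (pi : R) by rewrite cospi ct1 opprK.
have stp : sin t = sin (pi : R).
  by rewrite sinpi; have := cos2Dsin2 t; rewrite ctp cospi => s; nra.
have [+ _] := cos_sin_natmul m ctp stp.
rewrite c1' mulr_natl -[pi *+ m]add0r (alternatingn (@cosDpi R)) cos0 mulr1.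
by rewrite -signr_odd (negPf em) => ?; lra.
Qed.

End Closure.

(** * Endpoints in the hollow ball model *)

Section Endpoints.
Context {R : realType}.
Implicit Types (xi : 'rV[R]_3) (X : 'rV[R]_4) (s : R).

Definition sqnorm xi : R := xi 0 0 ^+ 2 + xi 0 1 ^+ 2 + xi 0 2 ^+ 2.

Lemma enormE xi : enorm xi = Num.sqrt (sqnorm xi).
Proof.
rewrite /enorm /sqnorm !big_ord_recl big_ord0 addr0 addrA.
by congr (Num.sqrt (_ ^+ 2 + _ ^+ 2 + _ ^+ 2)); congr (xi _ _); apply: val_inj.
Qed.

Lemma enorm_sqr xi : enorm xi ^+ 2 = sqnorm xi.
Proof. by rewrite enormE sqr_sqrtr// /sqnorm !addr_ge0 ?sqr_ge0. Qed.

(** The denominator delta of the hollow ball model; it is the positive root of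
    delta^2 - 2 t delta = 1 + t^2. *)
Definition scale_factor (t : R) : R := t + Num.sqrt (2 * t ^+ 2 + 1).

Lemma scale_factor_gt0 t : 0 < scale_factor t.
Proof.
have h : 0 <= 2 * t ^+ 2 + 1 by nra.
have := sqr_sqrtr h; have := sqrtr_ge0 (2 * t ^+ 2 + 1).
by rewrite /scale_factor; set q := Num.sqrt _ => q0 q2; nra.
Qed.

Lemma scale_factor_sqr t : scale_factor t ^+ 2 - 2 * t * scale_factor t
  = t ^+ 2 + 1.
Proof.
have h : 0 <= 2 * t ^+ 2 + 1 by nra.
by have := sqr_sqrtr h; rewrite /scale_factor; set q := Num.sqrt _ => q2; nra.
Qed.

Lemma hollow_ball_projE X (d := scale_factor (crd_t X)) :
  [/\ hollow_ball_proj X 0 0 = crd_x X / d,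
    hollow_ball_proj X 0 1 = crd_y X / d &
      hollow_ball_proj X 0 2 = crd_z X / d].
Proof. by rewrite /hollow_ball_proj -/(scale_factor _) !mxE /=
  ![_^-1 * _]mulrC. Qed.

(** On de Sitter space x^2 + y^2 + z^2 = 1 + t^2, and the quadratic equation for
    delta eliminates t.  The expression on the left of the second equation is
    the one that cuts out the hollow ball in [hollow_ballP]. *)
Lemma sqnorm_proj X : dS3 R X -> let d := scale_factor (crd_t X) in
  let q := sqnorm (hollow_ball_proj X) in
  q = (1 + crd_t X ^+ 2) / d ^+ 2 /\ q - (1 - q) ^+ 2 / 4 = d^-1 ^+ 2.
Proof.
rewrite /dS3/= /lorentz => XX.
have [x y z] := hollow_ball_projE X.
have d0 := scale_factor_gt0 (crd_t X); have d2 := scale_factor_sqr (crd_t X).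
rewrite /sqnorm x y z; move: d0 d2; set d := scale_factor _ => d0 d2.
have dn : d != 0 by rewrite gt_eqF.
have -> : (crd_x X / d) ^+ 2 + (crd_y X / d) ^+ 2 + (crd_z X / d) ^+ 2 =
   (1 + crd_t X ^+ 2) / d ^+ 2.
  by rewrite !expr_div_n -!mulrDl; congr (_ / _); lra.
split => //.
have -> : 1 + crd_t X ^+ 2 = d ^+ 2 - 2 * crd_t X * d by rewrite d2; ring.
have tE : crd_t X ^+ 2 = d ^+ 2 - 2 * crd_t X * d - 1 by rewrite d2; ring.
rewrite (_ : (d ^+ 2 - _) / d ^+ 2 = 1 - 2 * crd_t X / d); last by field.
rewrite (_ : _ - _ = 1 - 2 * crd_t X / d - crd_t X ^+ 2 / d ^+ 2);
  last by field.
by rewrite tE; field.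
Qed.

(** With r the norm, four times the expression on the right is
    ((r + 1)^2 - 2) (2 - (r - 1)^2). *)
Lemma hollow_ballP xi : hollow_ball xi <->
  0 < sqnorm xi - (1 - sqnorm xi) ^+ 2 / 4.
Proof.
rewrite /hollow_ball/= -enorm_sqr.
have r0 : 0 <= enorm xi by rewrite enormE sqrtr_ge0.
have s2 : Num.sqrt 2 ^+ 2 = 2 :> R by rewrite sqr_sqrtr.
have s0 : 0 <= Num.sqrt 2 :> R by exact: sqrtr_ge0.
move: r0 s2 s0; set r := enorm xi; set q := Num.sqrt 2 => r0 q2 q0.
have -> : r ^+ 2 - (1 - r ^+ 2) ^+ 2 / 4 =
    ((r + 1) ^+ 2 - 2) * (2 - (r - 1) ^+ 2) / 4 by field.
have q1 : 1 < q by nra.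
split=> [/andP[h1 h2]|h].
  by apply: divr_gt0 => //; apply: mulr_gt0; nra.
apply/andP; split; rewrite ltNge; apply/negP => h'.
  have h1 : (r + 1) ^+ 2 - 2 <= 0 by nra.
  have h2 : 0 <= 2 - (r - 1) ^+ 2 by nra.
  by move: h; rewrite pmulr_lgt0// => h; nra.
have h1 : 0 <= (r + 1) ^+ 2 - 2 by nra.
have h2 : 2 - (r - 1) ^+ 2 <= 0 by nra.
by move: h; rewrite pmulr_lgt0// => h; nra.
Qed.

Lemma sqnorm_continuous : continuous sqnorm.
Proof.
move=> xi; have c i := @coord_continuous R 1 3 0 i xi.
exact: (cvgD (cvgD (cvgM (c 0) (c 0)) (cvgM (c 1) (c 1))) (cvgM (c 2) (c 2))).
Qed.

Lemma enorm_continuous : continuous (@enorm R 3).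
Proof.
have -> : @enorm R 3 = Num.sqrt \o sqnorm by apply/funext => xi; exact: enormE.
move=> xi; apply: continuous_comp; [exact: sqnorm_continuous|exact:
  sqrt_continuous].
Qed.

Lemma proj_hollow_ball X : dS3 R X -> hollow_ball (hollow_ball_proj X).
Proof.
move=> /sqnorm_proj[_ E]; apply/hollow_ballP; rewrite E exprn_gt0// invr_gt0.
exact: scale_factor_gt0.
Qed.

Lemma hollow_ball_open : open (@hollow_ball R).
Proof.
rewrite (_ : hollow_ball = (@enorm R 3) @^-1` `]Num.sqrt 2 - 1,
  Num.sqrt 2 + 1[).
  by apply: open_comp (itv_open _ _) => xi _; exact: enorm_continuous.
by apply/seteqP; split=> xi; rewrite /hollow_ball /preimage /= in_itv.
Qed.

Lemma hollow_ball_boundary xi : topological_boundary hollow_ball xi ->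
  enorm xi = Num.sqrt 2 - 1 \/ enorm xi = Num.sqrt 2 + 1.
Proof.
move=> [cl nint].
have nb : ~ hollow_ball xi.
  by move=> hb; apply: nint; apply: open_nbhs_nbhs; split;
    [exact: hollow_ball_open|].
pose Z := (@enorm R 3) @^-1` `[Num.sqrt 2 - 1, Num.sqrt 2 + 1].
have cZ : closed Z.
  apply: (@closed_comp _ _ (@enorm R 3) `[Num.sqrt 2 - 1, Num.sqrt 2 + 1]).
    by move=> x _; exact: enorm_continuous.
  exact: itv_closed.
have BZ : hollow_ball `<=` Z.
  move=> x; rewrite /hollow_ball /Z /preimage /= in_itv /= => /andP[a b].
  by rewrite !ltW.
have := closure_subset BZ cl; rewrite -((closure_id _).1 cZ).
rewrite /Z /preimage /= in_itv /= !le_eqVlt => /andP[/predU1P[->|a]];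
  first by left.
by move=> /predU1P[->|b]; [right|case: nb; rewrite /hollow_ball/= a b].
Qed.

Definition axis_point (s : R) : 'rV[R]_3 := \row_(i < 3) [:: 0; 0; s]`_i.

Lemma sqnorm_axis_point s : sqnorm (axis_point s) = s ^+ 2.
Proof. by rewrite /sqnorm !mxE /=; ring. Qed.

Lemma enorm_axis_point s : enorm (axis_point s) = `|s|.
Proof. by rewrite enormE sqnorm_axis_point sqrtr_sqr. Qed.

Lemma axis_point_inj : injective axis_point.
Proof. by move=> s s' /rowP/(_ 2); rewrite !mxE. Qed.

Lemma card_axis_points (l : seq R) : uniq l ->
  (axis_point @` [set` l] #= `I_(size l))%card.
Proof.
move=> ul; have -> : axis_point @` [set` l]
  = (axis_point \o nth 0 l) @` `I_(size l).
  apply/seteqP; split=> [_ [s /= sl <-]|_ [i /= il <-]].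
    by exists (index s l) => /=; rewrite ?index_mem// nth_index.
  by exists (nth 0 l i) => //=; exact: mem_nth.
apply: inj_card_eq => i j; rewrite !inE /= => il jl /axis_point_inj/eqP.
by rewrite nth_uniq// => /eqP.
Qed.

End Endpoints.

Section CIIEndpoints.
Context {R : realType} (m : nat).
Hypothesis m_ge2 : (2 <= m)%N.
Implicit Types (xi : 'rV[R]_3) (X : 'rV[R]_4) (s : R).

(** On the image of CII the two sides are (x^2 + y^2) / delta^2 and
    (1 + amp^2) / delta^2.  In this form the bound is a closed condition, and on
    the ideal boundary its right-hand side vanishes. *)
Lemma closure_proj_CII_bound xi : closure (hollow_ball_proj @` CII R m) xi ->
  xi 0 0 ^+ 2 + xi 0 1 ^+ 2 <=
  (1 + amp m ^+ 2) * (sqnorm xi - (1 - sqnorm xi) ^+ 2 / 4).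
Proof.
pose Z := [set xi : 'rV[R]_3 | 0 <= (1 + amp m ^+ 2) *
  (sqnorm xi - (1 - sqnorm xi) ^+ 2 / 4)
  - (xi 0 0 ^+ 2 + xi 0 1 ^+ 2)].
have cZ : closed Z.
  apply: (@closed_comp _ _ (fun xi : 'rV[R]_3 => (1 + amp m ^+ 2) *
    (sqnorm xi - (1 - sqnorm xi) ^+ 2 / 4) - (xi 0 0 ^+ 2 + xi 0 1 ^+ 2))
    [set x | 0 <= x]); last exact: closed_ge.
  move=> x _; have c i := @coord_continuous R 1 3 0 i x.
  have cq := @sqnorm_continuous R x.
  pose p (q : R) := (1 + amp m ^+ 2) * (q - (1 - q) ^+ 2 / 4).
  have cp : continuous p.
    move=> q; have cq1 : (fun q : R => 1 - q) @ q --> 1 - q.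
      by apply: cvgB; [exact: cvg_cst|exact: cvg_id].
    apply: cvgM; first exact: cvg_cst.
    by apply: cvgB; [exact: cvg_id|apply: cvgM;
      [exact: (cvgM cq1 cq1)|exact: cvg_cst]].
  have cpq : {for x, continuous (p \o sqnorm)} by apply: continuous_comp;
    [exact: cq|exact: cp].
  exact: (cvgB cpq (cvgD (cvgM (c 0) (c 0)) (cvgM (c 1) (c 1)))).
suff IZ : hollow_ball_proj @` CII R m `<=` Z.
  by move=> /(closure_subset IZ); rewrite -((closure_id _).1 cZ) /Z/= subr_ge0.
move=> _ [X /(CII_dS3 m_ge2)[SX [t [xE yE]]] <-].
have [_ E] := sqnorm_proj SX; have [x y _] := hollow_ball_projE X.
rewrite /Z/= E x y [(crd_x X / _) ^+ 2]expr_div_n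
  [(crd_y X / _) ^+ 2]expr_div_n.
rewrite -mulrDl exprVn -mulrBl divr_ge0 ?sqr_ge0//.
rewrite xE yE !sqrrN gamma_norm// subr_ge0 lerD2l ler_piMr ?sqr_ge0//.
Qed.

(** The image in the hollow ball of the point (sg / h, x, y, sg tau / h), for
    h > 0 and signs sg and tau.  The formula is continuous at h = 0. *)
Definition limit_curve (sg tau x y h : R) : 'rV[R]_3 :=
  (sg + Num.sqrt (2 + h ^+ 2))^-1 *:
    \row_(i < 3) [:: h * x; h * y; sg * tau]`_i.

(** Follow a light-like line of CII to infinity: both t and z grow, with signs
    that can be prescribed, while x and y stay fixed. *)
Lemma axis_point_closure (sg tau : R) : sg = 1 \/ sg = -1 ->
  tau = 1 \/ tau = -1 ->
  closure (hollow_ball_proj @` CII R m)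
    (axis_point (sg * tau / (sg + Num.sqrt 2))).
Proof.
move=> sgE tauE.
have m0 : m%:R != 0 :> R := m_neq0 m_ge2.
pose t : R := pi / (2 * m%:R).
have ct : cos (m%:R * t) = 0.
  by rewrite (_ : _ * t = pi / 2) ?cos_pihalf// /t; field.
have sg2 : sg ^+ 2 = 1 by case: sgE => ->; rewrite ?sqrrN expr1n.
have tau2 : tau ^+ 2 = 1 by case: tauE => ->; rewrite ?sqrrN expr1n.
have s2 : Num.sqrt 2 ^+ 2 = 2 :> R by rewrite sqr_sqrtr.
have s0 : 0 <= Num.sqrt 2 :> R by exact: sqrtr_ge0.
have Q0 : limit_curve sg tau (- gamma_x m t) (- gamma_y m t) 0 =
    axis_point (sg * tau / (sg + Num.sqrt 2)).
  rewrite /limit_curve /axis_point expr0n/= addr0;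
    apply/rowP => -[[|[|[|//]]] i3];
    by rewrite !mxE /= ?mul0r ?mulr0// mulrC.
have D0 (h : R) : 0 < sg + Num.sqrt (2 + h ^+ 2).
  have h2 : 0 <= 2 + h ^+ 2 by nra.
  have := sqr_sqrtr h2; have := sqrtr_ge0 (2 + h ^+ 2);
    set q := Num.sqrt _ => q0 qq.
  by case: sgE => ->; nra.
move=> A; rewrite -Q0 => nA.
have cQ : {for 0, continuous (limit_curve sg tau (- gamma_x m t)
  (- gamma_y m t))}.
  have cD : (fun h : R => (sg + Num.sqrt (2 + h ^+ 2))^-1) @ (0 : R) -->
      (sg + Num.sqrt (2 + 0 ^+ 2))^-1.
    apply: cvgV; first by rewrite gt_eqF.
    apply: cvgD; first exact: cvg_cst.
    apply: continuous_cvg; first exact: sqrt_continuous.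
    apply: cvgD; first exact: cvg_cst.
    exact: (cvgM (cvg_id (F := nbhs (0 : R))) (cvg_id (F := nbhs (0 : R)))).
  apply: cvg_row => -[[|[|[|//]]] i3]; under eq_fun do rewrite !mxE /=;
    rewrite !mxE /=; apply: cvgM => //; try exact: cvg_cst; apply: cvgMl;
      exact: cvg_id.
have := cQ A nA; rewrite nbhs_simpl/= => /nbhs_ballP[d /= d0 dA].
pose h := d / 2; have h0 : 0 < h by rewrite divr_gt0.
pose X := vec4 (sg / h) (- gamma_x m t) (- gamma_y m t) (tau * sg / h).
exists (limit_curve sg tau (- gamma_x m t) (- gamma_y m t) h); split;
  last first.
  apply: dA; rewrite /ball/= sub0r normrN gtr0_norm// /h; lra.
exists X.
  apply/(CIIP m_ge2); exists t; rewrite /X !crd_vec4; split => //.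
  by rewrite !expr_div_n exprMn tau2 sg2 ct; ring.
have E : scale_factor (sg / h) = (sg + Num.sqrt (2 + h ^+ 2)) / h.
  rewrite /scale_factor [RHS]mulrDl; congr (_ + _).
  rewrite (_ : 2 * (sg / h) ^+ 2 + 1 = (2 + h ^+ 2) / h ^+ 2); last first.
    by rewrite expr_div_n sg2; field; rewrite gt_eqF.
  by rewrite sqrtrM ?sqrtrV ?sqrtr_sqr ?gtr0_norm//; nra.
rewrite /hollow_ball_proj /limit_curve -/(scale_factor _) /X !crd_vec4 E.
apply/rowP => -[[|[|[|//]]] i3]; rewrite !mxE /=; field; rewrite ?gt_eqF//.
Qed.

Lemma endpointsE : let q := Num.sqrt 2 in endpoints (CII R m) =
  axis_point @` [set` [:: q - 1; - (q - 1); q + 1; - (q + 1)]].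
Proof.
move=> q.
have s2 : q ^+ 2 = 2 :> R by rewrite sqr_sqrtr.
have s0 : 0 <= q :> R by exact: sqrtr_ge0.
have q1 : 1 < q by nra.
apply/seteqP; split=> xi.
  move=> [/closure_proj_CII_bound + /hollow_ball_boundary bd].
  have qz : sqnorm xi - (1 - sqnorm xi) ^+ 2 / 4 = 0.
    by rewrite -enorm_sqr; case: bd => ->; rewrite -/q; nra.
  rewrite qz mulr0 => b0.
  have [x0 y0] : xi 0 0 = 0 /\ xi 0 1 = 0 by split; nra.
  have z2 : xi 0 2 ^+ 2 = enorm xi ^+ 2.
    by rewrite enorm_sqr /sqnorm x0 y0; ring.
  exists (xi 0 2); last first.
    apply/rowP => -[[|[|[|//]]] i3]; rewrite mxE /=.
    - by rewrite -x0; congr (xi _ _); exact: val_inj.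
    - by rewrite -y0; congr (xi _ _); exact: val_inj.
    - by congr (xi _ _); exact: val_inj.
  move/eqP: z2; rewrite eqf_sqr /= !inE.
  by case: bd => -> /orP[]/eqP->; rewrite eqxx ?orbT.
move=> [s /= sl <-].
have [sg [tau [sgE tauE sE]]] : exists sg tau :
  R, [/\ sg = 1 \/ sg = -1, tau = 1 \/ tau = -1 &
    s = sg * tau / (sg + q)].
  move: sl; rewrite !inE => /or4P[]/eqP->.
  - exists 1, 1; split; [by left|by left|].
    by apply: (mulIf (_ : 1 + q != 0)); rewrite ?divfK ?gt_eqF//; nra.
  - exists 1, (-1); split; [by left|by right|].
    by apply: (mulIf (_ : 1 + q != 0)); rewrite ?divfK ?gt_eqF//; nra.
  - exists (-1), (-1); split; [by right|by right|].
    by apply: (mulIf (_ : -1 + q != 0)); rewrite ?divfK ?gt_eqF//; nra.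
  - exists (-1), 1; split; [by right|by left|].
    by apply: (mulIf (_ : -1 + q != 0)); rewrite ?divfK ?gt_eqF//; nra.
have cl := axis_point_closure sgE tauE; rewrite -/q -sE in cl.
split => //; split.
  apply: closure_subset cl => _ [X /(CII_dS3 m_ge2)[SX _] <-].
  exact: proj_hollow_ball.
move=> /interior_subset/hollow_ballP; rewrite sqnorm_axis_point.
suff -> : s ^+ 2 - (1 - s ^+ 2) ^+ 2 / 4 = 0 by rewrite ltxx.
by move: sl; rewrite !inE => /or4P[]/eqP->; nra.
Qed.

Lemma card_endpoints : [/\ (endpoints (CII R m) #= `I_4)%card,
  (endpoints (CII R m) `&` ideal_boundary_plus R #= `I_2)%card &
  (endpoints (CII R m) `&` ideal_boundary_minus R #= `I_2)%card].
Proof.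
have := endpointsE; set q := Num.sqrt 2 => /= E.
have s2 : q ^+ 2 = 2 :> R by rewrite sqr_sqrtr.
have s0 : 0 <= q :> R by exact: sqrtr_ge0.
have q1 : 1 < q by nra.
split.
- rewrite E; apply: card_axis_points; rewrite /= !inE !negb_or !andbT.
  by clear E; do !(apply/andP; split); apply/eqP => ?; lra.
- have : endpoints (CII R m) `&` ideal_boundary_plus R =
      axis_point @` [set` [:: q - 1; - (q - 1)]].
    rewrite E; clear E; apply/seteqP; split=> y.
      move=> [[s /= sl <-]]; rewrite /ideal_boundary_plus/= enorm_axis_point
        -/q => se.
      exists s => //; move: sl se; rewrite /= !inE => /or4P[]/eqP->;
        rewrite ?normrN.
      - by rewrite eqxx.
      - by rewrite eqxx orbT.
      - by rewrite gtr0_norm; lra.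
      - by rewrite gtr0_norm; lra.
    move=> [s sl <-]; split; last first.
      rewrite /ideal_boundary_plus/= enorm_axis_point -/q; move: sl => /=.
      by rewrite !inE => /orP[]/eqP->; rewrite ?normrN gtr0_norm//; lra.
    by exists s => //; move: sl; rewrite /= !inE => /orP[]->; rewrite ?orbT.
  move=> ->; clear E; by apply: card_axis_points; rewrite /= !inE andbT;
    apply/eqP => ?; lra.
- have : endpoints (CII R m) `&` ideal_boundary_minus R =
      axis_point @` [set` [:: q + 1; - (q + 1)]].
    rewrite E; clear E; apply/seteqP; split=> y.
      move=> [[s /= sl <-]]; rewrite /ideal_boundary_minus/= enorm_axis_point
        -/q => se.
      exists s => //; move: sl se; rewrite /= !inE => /or4P[]/eqP->;
        rewrite ?normrN.
      - by rewrite gtr0_norm; lra.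
      - by rewrite gtr0_norm; lra.
      - by rewrite eqxx.
      - by rewrite eqxx orbT.
    move=> [s sl <-]; split; last first.
      rewrite /ideal_boundary_minus/= enorm_axis_point -/q; move: sl => /=.
      by rewrite !inE => /orP[]/eqP->; rewrite ?normrN gtr0_norm//; lra.
    by exists s => //; move: sl; rewrite /= !inE => /orP[]->; rewrite ?orbT.
  move=> ->; clear E; by apply: card_axis_points; rewrite /= !inE andbT;
    apply/eqP => ?; lra.
Qed.

End CIIEndpoints.

(** * The analytic immersion *)

Section Immersion.
Context {R : realType} (m : nat).
Hypothesis m_ge2 : (2 <= m)%N.

(** Two binary choices give four maps: (-1)^i is the sign of the nonzero
    light-cone coordinate, and the parity of i./2 tells which one it is. *)
Definition patch (i : nat) (x : 'rV[R]_2) : 'rV[R]_4 :=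
  swap_lightpt m (odd i./2) ((-1) ^+ i * expR (x 0 0))
    ((-1) ^+ i * (amp m ^+ 2 * cos (m%:R * x 0 1) ^+ 2 * expR (- x 0 0)))
      (x 0 1).

Lemma swap_lightptE b (u v t : R) : swap_lightpt m b u v t =
  vec4 ((u + v) / 2) (- gamma_x m t) (- gamma_y m t) ((-1) ^+ b * (u - v) / 2).
Proof. by case: b; rewrite /swap_lightpt /lightpt; congr vec4; ring. Qed.

Lemma signr_neq0 i : (-1) ^+ i != 0 :> R.
Proof. by rewrite signr_eq0. Qed.

Lemma patch_product i (x : 'rV[R]_2) : (-1) ^+ i * expR (x 0 0) *
    ((-1) ^+ i * (amp m ^+ 2 * cos (m%:R * x 0 1) ^+ 2 * expR (- x 0 0)))
  = amp m ^+ 2 * cos (m%:R * x 0 1) ^+ 2.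
Proof.
have e : expR (x 0 0) * expR (- x 0 0) = 1 by rewrite expRxMexpNx_1.
have s : (-1) ^+ i * (-1) ^+ i = 1 :> R by rewrite -expr2 sqrr_sign.
transitivity ((-1) ^+ i * (-1) ^+ i * (amp m ^+ 2 * cos (m%:R * x 0 1) ^+ 2) *
  (expR (x 0 0) * expR (- x 0 0))); first by ring.
by rewrite e s mulr1 mul1r.
Qed.

Lemma swap_lightpt_cone b (u v t : R) : u != 0 ->
  u * v = amp m ^+ 2 * cos (m%:R * t) ^+ 2 ->
  (CII R m `\` cone_like_singularities R m) (swap_lightpt m b u v t).
Proof.
move=> u0 uv; split.
  by case: b; apply: CII_lightpt; rewrite // mulrC.
move=> /(cone_like_singularity_crd m_ge2)[_].
rewrite swap_lightptE !crd_vec4 => t0 z0; move/eqP: u0; apply.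
by case: b z0; rewrite ?expr0 ?expr1; lra.
Qed.

(** A point of CII with u = v = 0 is a cone-like singularity. *)
Lemma patch_range X : (exists i x, (i < 4)%N /\ patch i x = X) <->
  (CII R m `\` cone_like_singularities R m) X.
Proof.
split=> [[i [x [i4 <-]]]|[/(CII_ex_lightpt m_ge2)[u [v [t [uv XE]]]] nc]].
  apply: swap_lightpt_cone; last exact: patch_product.
  by rewrite mulf_neq0// ?signr_neq0// gt_eqF// expR_gt0.
have H (b : bool) (u' v' : R) : u' != 0 ->
  u' * v' = amp m ^+ 2 * cos (m%:R * t) ^+ 2 ->
    exists i x, (i < 4)%N /\ patch i x = swap_lightpt m b u' v' t.
  move=> u0 uv'.
  exists ((u' < 0)%R + b.*2)%N, (\row_(j < 2) [:: ln `|u'|; t]`_j).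
  split; first by case: b; case: (u' < 0)%R.
  have u0' : 0 < `|u'| by rewrite normr_gt0.
  rewrite /patch !mxE /= expRN lnK ?posrE//.
  have -> : (-1) ^+ ((u' < 0)%R + b.*2) * `|u'| = u'.
    by rewrite -signr_odd oddD odd_double addbF oddb -numEsign.
  have -> : odd ((u' < 0)%R + b.*2)./2 = b by case: b; case: (u' < 0)%R.
  congr swap_lightpt; apply: (mulfI u0); rewrite uv' {1}[u']numEsign.
  rewrite -[(-1) ^+ (_ + _)]signr_odd oddD odd_double addbF oddb mulrACA
    -expr2 sqrr_sign mul1r.
  by rewrite mulrC divfK ?gt_eqF.
have [u0|u0] := eqVneq u 0; last by rewrite XE; exact: (H false).
have [v0|v0] := eqVneq v 0; last by rewrite XE; apply: (H true) => //;
  rewrite mulrC.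
case: nc; apply/(cone_like_singularityP m_ge2); exists t; split;
  last by rewrite XE u0 v0.
move/eqP: uv; rewrite u0 mul0r eq_sym mulf_eq0 !sqrf_eq0 gt_eqF ?amp_gt0//=.
by move=> /eqP.
Qed.

Definition dgamma_x (t : R) : R :=
  (1 - m%:R ^+ 2) / 2 * sin (m%:R * t) * cos t
  + (m%:R ^+ 2 - 1) / (2 * m%:R) * cos (m%:R * t) * sin t.
Definition dgamma_y (t : R) : R :=
  (1 - m%:R ^+ 2) / 2 * sin (m%:R * t) * sin t
  - (m%:R ^+ 2 - 1) / (2 * m%:R) * cos (m%:R * t) * cos t.

Lemma is_derive_cos_natmul (t : R) :
  is_derive t 1 (fun t : R => cos (m%:R * t)) (- (m%:R * sin (m%:R * t))).
Proof.
have h : is_derive t 1 (fun t : R => m%:R * t) (m%:R * 1).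
  exact: (is_deriveZ _ (is_derive_id t 1)).
have := is_derive1_comp (is_derive_cos (m%:R * t)) h.
by rewrite mulr1 mulrC mulrN.
Qed.

Lemma is_derive_sin_natmul (t : R) :
  is_derive t 1 (fun t : R => sin (m%:R * t)) (m%:R * cos (m%:R * t)).
Proof.
have h : is_derive t 1 (fun t : R => m%:R * t) (m%:R * 1).
  exact: (is_deriveZ _ (is_derive_id t 1)).
have := is_derive1_comp (is_derive_sin (m%:R * t)) h.
by rewrite mulr1 mulrC.
Qed.

Lemma is_derive_gamma_x (t : R) : is_derive t 1 (gamma_x m) (dgamma_x t).
Proof.
have dC := is_derive_cos_natmul t; have dS := is_derive_sin_natmul t.
have m0 : m%:R != 0 :> R := m_neq0 m_ge2.
apply: is_derive_eq (is_deriveD (is_deriveM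
  (is_deriveZ ((m%:R ^+ 2 + 1) / (2 * m%:R)) dC)
  (is_derive_cos t)) (is_deriveM dS (is_derive_sin t))) _.
set a := (m%:R ^+ 2 + 1) / (2 * m%:R).
transitivity (a * cos (m%:R * t) * (- sin t)
  + cos t * (a * - (m%:R * sin (m%:R * t)))
  + (sin (m%:R * t) * cos t + sin t * (m%:R * cos (m%:R * t)))); first by [].
by rewrite /dgamma_x /a; field.
Qed.

Lemma is_derive_gamma_y (t : R) : is_derive t 1 (gamma_y m) (dgamma_y t).
Proof.
have dC := is_derive_cos_natmul t; have dS := is_derive_sin_natmul t.
have m0 : m%:R != 0 :> R := m_neq0 m_ge2.
apply: is_derive_eq (is_deriveB (is_deriveM
  (is_deriveZ ((m%:R ^+ 2 + 1) / (2 * m%:R)) dC)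
  (is_derive_sin t)) (is_deriveM dS (is_derive_cos t))) _.
set a := (m%:R ^+ 2 + 1) / (2 * m%:R).
transitivity (a * cos (m%:R * t) * cos t
  + sin t * (a * - (m%:R * sin (m%:R * t)))
  - (sin (m%:R * t) * (- sin t) + cos t * (m%:R * cos (m%:R * t))));
      first by [].
by rewrite /dgamma_y /a; field.
Qed.

(** The squared speed is ((m^2 - 1) / 2)^2 sin^2 (m t) + amp^2 cos^2 (m t). *)
Lemma dgamma_neq0 t : dgamma_x t ^+ 2 + dgamma_y t ^+ 2 != 0.
Proof.
have m2 := m_geR (R := R) m_ge2; have a0 := amp_gt0 (R := R) m_ge2.
rewrite gt_eqF//.
have -> : dgamma_x t ^+ 2 + dgamma_y t ^+ 2 =
   (((1 - m%:R ^+ 2) / 2) ^+ 2 * sin (m%:R * t) ^+ 2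
     + amp m ^+ 2 * cos (m%:R * t) ^+ 2) * (cos t ^+ 2 + sin t ^+ 2).
  by rewrite /dgamma_x /dgamma_y /amp; ring.
rewrite cos2Dsin2 mulr1.
have := cos2Dsin2 (m%:R * t) => e.
have [c0|c0] := eqVneq (cos (m%:R * t)) 0.
  have -> : sin (m%:R * t) ^+ 2 = 1 by move: e; rewrite c0; lra.
  by rewrite c0 expr0n/= mulr0 addr0 mulr1 exprn_even_gt0//= mulf_neq0//
    subr_eq0 lt_eqF//; nra.
apply: ltr_wpDl; first by rewrite mulr_ge0 ?sqr_ge0.
by rewrite mulr_gt0// exprn_even_gt0//= gt_eqF.
Qed.

Lemma patch_elementary (U : set 'rV[R]_2) i j :
  elementary U (fun x => patch i x 0 j).
Proof.
case: j => -[|[|[|[|//]]]] j4; under eq_fun do rewrite /patch swap_lightptE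
  mxE /=;
  rewrite /gamma_x /gamma_y; prove_elementary.
Qed.

(** The sums over the two frequencies m + 1 and m - 1 of the trochoid are linear
    in entire functions of the angle, which suits analyticity. *)
Lemma gamma_x_sum t : gamma_x m t =
  (m%:R - 1) ^+ 2 / (4 * m%:R) * cos ((m%:R + 1) * t)
  + (m%:R + 1) ^+ 2 / (4 * m%:R) * cos ((m%:R - 1) * t) :> R.
Proof.
have m0 : m%:R != 0 :> R := m_neq0 m_ge2.
rewrite /gamma_x [(m%:R + 1) * t]mulrDl [(m%:R - 1) * t]mulrDl mul1r mulN1r
  cosD cosB.
by field.
Qed.

Lemma gamma_y_sum t : gamma_y m t =
  (m%:R - 1) ^+ 2 / (4 * m%:R) * sin ((m%:R + 1) * t)
  - (m%:R + 1) ^+ 2 / (4 * m%:R) * sin ((m%:R - 1) * t) :> R.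
Proof.
have m0 : m%:R != 0 :> R := m_neq0 m_ge2.
rewrite /gamma_y [(m%:R + 1) * t]mulrDl [(m%:R - 1) * t]mulrDl mul1r mulN1r
  sinD sinB.
by field.
Qed.

(** The squared cosine is linearised in order to have a sum of products of
    one-variable functions with known expansions. *)
Lemma patch_height_analytic (a b : R) p : analytic_at (fun x : 'rV[R]_2 =>
  a * expR (x 0 0) + b * (cos (m%:R * x 0 1) ^+ 2 * expR (- x 0 0))) p.
Proof.
have -> : (fun x : 'rV[R]_2 => a * expR (x 0 0)
  + b * (cos (m%:R * x 0 1) ^+ 2 * expR (- x 0 0)))
  = (fun x => a * (expR (1 * x 0 0) * 1) + (b / 2 * (expR (-1 * x 0 0) * 1) +
      b / 2 * (expR (-1 * x 0 0) * cos (2 * m%:R * x 0 1)))).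
  apply/funext => x; rewrite -[2 * m%:R * _]mulrA [2 * (_ * _)]mulr_natl
    cos_mulr2n mul1r mulN1r.
  by field.
exact: (analytic_atD (analytic_atZ _ (analytic_at_mul2 _
  (entire_expR 1) entire_one))
  (analytic_atD (analytic_atZ _ (analytic_at_mul2 _
    (entire_expR (-1)) entire_one))
  (analytic_atZ _ (analytic_at_mul2 _ (entire_expR (-1)) (entire_cos _))))).
Qed.

Lemma patch_analytic i : analytic_on setT (patch i).
Proof.
move=> p _ [[|[|[|[|//]]]] j4]; under eq_fun do rewrite /patch swap_lightptE
  mxE /=.
- have := patch_height_analytic ((-1) ^+ i / 2) ((-1) ^+ i * amp m ^+ 2 / 2) p.
  by congr analytic_at; apply/funext => x; field.
- under eq_fun do rewrite gamma_x_sum opprD -!mulNr.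
  exact: (analytic_atD (analytic_atZ _ (analytic_at_snd _ (entire_cos _)))
    (analytic_atZ _ (analytic_at_snd _ (entire_cos _)))).
- under eq_fun do rewrite gamma_y_sum opprD opprK -mulNr.
  exact: (analytic_atD (analytic_atZ _ (analytic_at_snd _ (entire_sin _)))
    (analytic_atZ _ (analytic_at_snd _ (entire_sin _)))).
- have := patch_height_analytic ((-1) ^+ odd i./2 * (-1) ^+ i / 2)
    (- ((-1) ^+ odd i./2 * (-1) ^+ i * amp m ^+ 2 / 2)) p.
  by congr analytic_at; apply/funext => x; field.
Qed.

Lemma patch_differentiable i p : differentiable (patch i) p.
Proof.
apply: differentiable_row => j.
by apply: (@elementary_differentiable _ _ setT) => //; exact: patch_elementary.
Qed.

Lemma patch_crd i (x : 'rV[R]_2) :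
  [/\ patch i x 0 1 = - gamma_x m (x 0 1), patch i x 0 2 = - gamma_y m (x 0 1) &
    patch i x 0 0 + (-1) ^+ odd i./2 * patch i x 0 3
      = (-1) ^+ i * expR (x 0 0)].
Proof.
rewrite /patch swap_lightptE !mxE /=; split => //.
by case: (odd _); rewrite /= ?expr0 ?expr1; field.
Qed.

(** The x and y coordinates detect the angular direction, because the curve is
    regular, and the nonzero light-cone coordinate, an exponential up to sign,
    detects the other one. *)
Lemma patch_immersed i p h : 'D_h (patch i) p = 0 -> h = 0.
Proof.
have dp := patch_differentiable i p.
move=> /(derive_component dp) D0.
have gx0 : dgamma_x (p 0 1) * h 0 1 = 0.
  apply: oppr_inj; rewrite oppr0 -mulNr -(D0 1).
  rewrite -(derive_of_crd _ (is_deriveN (is_derive_gamma_x (p 0 1)))).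
  by congr ('D_h _ p); apply/funext => x; have [-> _ _] := patch_crd i x.
have gy0 : dgamma_y (p 0 1) * h 0 1 = 0.
  apply: oppr_inj; rewrite oppr0 -mulNr -(D0 2).
  rewrite -(derive_of_crd _ (is_deriveN (is_derive_gamma_y (p 0 1)))).
  by congr ('D_h _ p); apply/funext => x; have [_ -> _] := patch_crd i x.
have h1 : h 0 1 = 0.
  apply: (mulfI (dgamma_neq0 (p 0 1))).
  by rewrite mulr0 mulrDl !expr2 -!mulrA gx0 gy0 !mulr0 addr0.
have e0 : (-1) ^+ i * expR (p 0 0) * h 0 0 = 0.
  rewrite -(derive_of_crd _ (is_deriveZ ((-1) ^+ i) (is_derive_expR (p 0 0)))).
  have dj j : derivable (fun x => patch i x 0 j) p h.
    have dh : derivable (patch i) p h by exact: diff_derivable.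
    by move/derivable_mxP: dh; apply.
  transitivity ('D_h ((fun x => patch i x 0 0) +
      (-1) ^+ odd i./2 *: (fun x => patch i x 0 3)) p).
    by congr ('D_h _ p); apply/funext => x; have [_ _ E] := patch_crd i x;
      exact: esym E.
  by rewrite deriveD ?deriveZ ?D0 ?scaler0 ?addr0//; exact: derivableZ.
have h0 : h 0 0 = 0.
  move/eqP: e0; rewrite !mulf_eq0 (negPf (signr_neq0 i)) /= gt_eqF ?expR_gt0//=.
  by move/eqP.
apply/rowP => -[[|[|//]] j2]; rewrite mxE.
  by rewrite -[RHS]h0; congr (h _ _); exact: val_inj.
by rewrite -[RHS]h1; congr (h _ _); exact: val_inj.
Qed.

Lemma sheets_plane_point : sheets 4 [set: 'rV[R]_2].
Proof. by exists (0%N, 0); rewrite inE. Qed.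

Definition patches (p : sheets 4 [set: 'rV[R]_2]) : 'rV[R]_4 :=
  patch (sheet_of p) (sheet_point p).

(** The smooth and the analytic structure are treated by the same argument, with
    the class of regular maps as a parameter. *)
Lemma patches_immersion (reg : @regularity R)
    (reg_local : forall n k (U : set 'rV[R]_n) (f g : 'rV[R]_n -> 'rV[R]_k),
       open U -> (forall x, U x -> f x = g x) -> reg n k U g -> reg n k U f)
    (reg_id : forall n (U : set 'rV[R]_n), open U -> reg n n U id) :
  (forall i, reg 2%N 4%N setT (patch i)) ->
  immersion (dS3 R)
    (patches : sheets_manifold openT sheets_plane_point reg_local reg_id ->
      'rV[R]_4)
  /\ range patches = CII R m `\` cone_like_singularities R m.
Proof.
move=> rpatch; split.
  apply: (@sheets_immersion _ _ _ _ _ _ _ _ _ _ _ patch) =>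
    // [i x i4 _|i x _ _].
    have [] : (CII R m `\` cone_like_singularities R m) (patch i x).
      by apply/patch_range; exists i, x.
    by move=> /(CII_dS3 m_ge2)[].
  by split; [exact: patch_differentiable|move=> h; exact: patch_immersed].
apply/seteqP; split=> [_ [p _ <-]|X /patch_range[i [x [i4 <-]]]].
  apply/patch_range; exists (sheet_of p), (sheet_point p); split => //.
  exact: (sheetsP p).1.
exists (sheet_inv sheets_plane_point i x) => //.
by rewrite /patches; have [-> ->] := sheet_invP sheets_plane_point i4
  (I : setT x).
Qed.

Lemma CII_almost_immersed : almost_immersed (dS3 R) (CII R m).
Proof.
exists (cone_like_singularities R m); split.
  exact: discrete_cone_like_singularities.
exists 2%N, (sheets_manifold openT sheets_plane_point smooth_on_local
  smooth_on_id), patches.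
apply: patches_immersion => i; apply: elementary_smooth; first exact: openT.
by move=> j; exact: patch_elementary.
Qed.

Lemma patch_fII_image i (x : 'rV[R]_2) :
  (-1) ^+ i * cos (m%:R * x 0 1) < 0 -> fII_image R m (patch i x).
Proof.
move=> ic; apply: (fII_image_swap m_ge2); first exact: patch_product.
by rewrite mulrAC pmulr_llt0 ?expR_gt0.
Qed.

(** Each copy of the plane is connected by segments, so a component contains the
    whole copy of each of its points. *)
Lemma sheet_connected (p : sheets 4 [set: 'rV[R]_2]) :
  sheet_dom (sheet_of p) `<=` connected_component setT p.
Proof.
move=> q qp; have [i4 _] := sheetsP p.
pose g (s : R) := sheet_inv sheets_plane_point (sheet_of p)
  (sheet_point p + s *: (sheet_point q - sheet_point p)).
have cg : continuous g.
  move=> s; apply: (@continuous_comp _ _ _ (fun s : R => sheet_point p +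
      s *: (sheet_point q - sheet_point p)) (sheet_inv sheets_plane_point _)).
    apply: cvgD; first exact: cvg_cst.
    by apply: cvgZl; exact: cvg_id.
  exact: (@sheet_inv_continuous _ _ _ _ openT sheets_plane_point (Ordinal i4)).
apply: (@connected_component_max _ _ (range g)) => //.
- exists 0 => //; rewrite /g scale0r addr0; exact: sheet_invK.
- apply: connected_continuous_connected; last exact: continuous_subspaceT.
  by apply/connected_intervalP.
- exists 1 => //; rewrite /g scale1r addrC subrK.
  by rewrite -qp; exact: sheet_invK.
Qed.

Lemma CII_analytic_extension : analytic_extension (dS3 R) (CII R m)
  (fII_image R m).
Proof.
split; first exact: fII_image_CII.
exists (cone_like_singularities R m); split.
  exact: discrete_cone_like_singularities.
exists (sheets_manifold openT sheets_plane_point analytic_on_local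
  analytic_on_id), patches.
have [iP rP] := patches_immersion analytic_on_local analytic_on_id
  patch_analytic.
split => // p.
(* The angles over which the copy of p lies on the catenoid. *)
pose good : set R := [set s | (-1) ^+ sheet_of p * cos (m%:R * s) < 0].
exists (sheet_dom (sheet_of p) `&` [set q | good (sheet_point q 0 1)]).
split.
- apply: openI; first exact: sheet_dom_open.
  have ogood : open good.
    apply: (@open_comp _ _ (fun s : R => (-1) ^+ sheet_of p * cos (m%:R * s))
      [set x | x < 0]).
      move=> s _; apply: cvgM; first exact: cvg_cst.
      exact: cos_natmul_continuous.
    exact: open_lt.
  apply: (@open_comp _ _ (fun q : sheets 4 [set: 'rV[R]_2] =>
    sheet_point q 0 1) good) => //.
  move=> q _; apply: (@continuous_comp _ _ _ (@sheet_point _ _ _ _)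
    (fun x : 'rV[R]_2 => x 0 1)).
    exact: sheet_point_continuous.
  exact: coord_continuous.
- have [s gs] : good !=set0.
    have m0 : m%:R != 0 :> R := m_neq0 m_ge2.
    rewrite /good; case: (boolP (odd (sheet_of p))) => o.
      by exists 0; rewrite /= mulr0 cos0 -signr_odd o expr1 mulr1; lra.
    exists (pi / m%:R); rewrite /= [m%:R * _]mulrC divfK// cospi -signr_odd
      (negPf o) expr0.
    by lra.
  exists (sheet_inv sheets_plane_point (sheet_of p) (const_mx s)).
  have [i4 _] := sheetsP p.
  have [? E] := sheet_invP sheets_plane_point i4 (I : setT (const_mx s)).
  by split => //=; rewrite E mxE.
- by move=> q [qp _]; exact: sheet_connected.
- move=> _ [q [qp gq] <-]; apply: patch_fII_image.
  by rewrite qp.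
Qed.

End Immersion.

(** * Embeddedness over a simple closed curve *)

Section Embedding.
Context {R : realType} (m : nat).
Hypothesis m_ge2 : (2 <= m)%N.

(** A parametrization of the curve - gamma_m by the unit circle which is onto,
    regular and has a continuous inverse; such a parametrization exists when
    the curve is simple.  The map is given in the coordinates (c, s) of the
    plane, and dpx and dpy are the directional derivatives of px and py; in
    [profile_immersed], (dc, ds) is tangent to the circle. *)
Record circle_profile (px py : R -> R -> R) (dpx dpy : R -> R -> R -> R -> R) :
    Prop := CircleProfile {
  profile_of_gamma : forall t, exists c s, [/\ c ^+ 2 + s ^+ 2 = 1,
    px c s = - gamma_x m t & py c s = - gamma_y m t];
  gamma_of_profile : forall c s, c ^+ 2 + s ^+ 2 = 1 ->
    exists t, px c s = - gamma_x m t /\ py c s = - gamma_y m t;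
  profile_elementary : forall (U : set 'rV[R]_2) f g,
    elementary U f -> elementary U g ->
    elementary U (fun x => px (f x) (g x))
      /\ elementary U (fun x => py (f x) (g x));
  profile_derive : forall (p h : 'rV[R]_2) (f g : 'rV[R]_2 -> R) (df dg : R),
    is_derive p h f df -> is_derive p h g dg ->
    is_derive p h (fun x => px (f x) (g x)) (dpx (f p) (g p) df dg) /\
    is_derive p h (fun x => py (f x) (g x)) (dpy (f p) (g p) df dg);
  profile_immersed : forall c s dc ds, c ^+ 2 + s ^+ 2 = 1 ->
    c * dc + s * ds = 0 -> dpx c s dc ds = 0 -> dpy c s dc ds = 0 ->
    dc = 0 /\ ds = 0;
  profile_inverse : forall (c0 s0 e : R), c0 ^+ 2 + s0 ^+ 2 = 1 -> 0 < e ->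
    exists2 d : R, 0 < d & forall c s, c ^+ 2 + s ^+ 2 = 1 ->
      `|px c s - px c0 s0| < d -> `|py c s - py c0 s0| < d ->
      `|c - c0| < e /\ `|s - s0| < e
}.

Variables (px py : R -> R -> R) (dpx dpy : R -> R -> R -> R -> R).
Hypothesis profileP : circle_profile px py dpx dpy.

Implicit Types w : 'rV[R]_2.

(** The punctured plane stands for the cylinder over the circle: the point
    e^(z / 2) (c, s), with (c, s) on the circle, represents ((c, s), z).  Thus z
    is the logarithm of the squared radius. *)
Definition radius2 w : R := w 0 0 ^+ 2 + w 0 1 ^+ 2.
Definition cosw w : R := w 0 0 * (Num.sqrt (radius2 w))^-1.
Definition sinw w : R := w 0 1 * (Num.sqrt (radius2 w))^-1.
Definition xw w : R := px (cosw w) (sinw w).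
Definition yw w : R := py (cosw w) (sinw w).
Definition t2w w : R := ln (radius2 w) ^+ 2 + (xw w ^+ 2 + yw w ^+ 2 - 1).

Definition punctured : set 'rV[R]_2 := [set w | 0 < radius2 w].
Definition graph_dom : set 'rV[R]_2 := [set w | 0 < radius2 w /\ 0 < t2w w].

Lemma radius2_elementary U : elementary U radius2.
Proof. rewrite /radius2; prove_elementary. Qed.

Section Elementary.
Variable U : set 'rV[R]_2.
Hypothesis U0 : forall w, U w -> 0 < radius2 w.

Lemma cosw_sinw_elementary : elementary U cosw /\ elementary U sinw.
Proof.
split; (apply: elementaryM; first exact: elementary_crd);
  (apply: elementaryV; last by move=> w Uw; rewrite gt_eqF// sqrtr_gt0 U0);
  by apply: elementary_sqrt => //; exact: radius2_elementary.
Qed.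

Lemma xw_yw_elementary : elementary U xw /\ elementary U yw.
Proof. have [ec es] := cosw_sinw_elementary;
  exact: (profile_elementary profileP). Qed.

Lemma ln_radius2_elementary : elementary U (fun w => ln (radius2 w)).
Proof. by apply: elementary_ln => //; exact: radius2_elementary. Qed.

Lemma t2w_elementary : elementary U t2w.
Proof.
have [ex ey] := xw_yw_elementary; have el := ln_radius2_elementary.
rewrite /t2w; prove_elementary.
Qed.

End Elementary.

Lemma punctured_open : open punctured.
Proof.
apply: (@open_comp _ _ radius2 [set x | 0 < x]); last exact: open_gt.
move=> w _; exact: (elementary_continuous (radius2_elementary setT)).
Qed.

Lemma graph_dom_open : open graph_dom.
Proof.
rewrite openE => w [r0 t0]; rewrite /interior.
have ct : {for w, continuous t2w}.
  exact: (elementary_continuous (t2w_elementary (U := punctured) _)).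
have n1 : nbhs w punctured by apply: open_nbhs_nbhs; split => //;
  exact: punctured_open.
have n2 : nbhs w (t2w @^-1` [set x | 0 < x]).
  by apply: ct; apply: open_nbhs_nbhs; split => //; exact: open_gt.
by apply: filterS2 n1 n2.
Qed.

Lemma graph_dom_radius w : graph_dom w -> 0 < radius2 w.
Proof. by case. Qed.

Lemma cosw_sinw_circle w : 0 < radius2 w -> cosw w ^+ 2 + sinw w ^+ 2 = 1.
Proof.
move=> r0; rewrite /cosw /sinw !exprMn -mulrDl exprVn sqr_sqrtr ?ltW//.
by rewrite divff// gt_eqF.
Qed.

Lemma profile_norm c s : c ^+ 2 + s ^+ 2 = 1 ->
  0 <= px c s ^+ 2 + py c s ^+ 2 - 1.
Proof.
move=> /(gamma_of_profile profileP)[t [-> ->]];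
  rewrite !sqrrN gamma_norm// addrC addKr.
by rewrite mulr_ge0// sqr_ge0.
Qed.

(** The graph of a square root over the cylinder, restricted to the domain where
    the root is positive.  The values i = 0 and i = 1 give the parts of CII with
    t > 0 and t < 0. *)
Definition half_sheet (i : nat) w : 'rV[R]_4 :=
  vec4 ((-1) ^+ i * Num.sqrt (t2w w)) (xw w) (yw w) (ln (radius2 w)).

Lemma half_sheet_elementary i j : elementary graph_dom
  (fun w => half_sheet i w 0 j).
Proof.
have [ex ey] := xw_yw_elementary graph_dom_radius.
have el := ln_radius2_elementary graph_dom_radius.
case: j => -[|[|[|[|//]]]] j4; under eq_fun do rewrite mxE /=; try by [].
apply: elementaryM; first exact: elementary_cst.
apply: elementary_sqrt; first exact: (t2w_elementary graph_dom_radius).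
by move=> w [].
Qed.

Lemma half_sheet_differentiable i w : graph_dom w ->
  differentiable (half_sheet i) w.
Proof.
move=> Ow; apply: differentiable_row => j.
exact: (elementary_differentiable (half_sheet_elementary i j)).
Qed.

(** The coordinate z detects the radial direction, x and y the direction tangent
    to the circle. *)
Lemma half_sheet_immersed i w h : graph_dom w -> 'D_h (half_sheet i) w = 0 ->
  h = 0.
Proof.
move=> Ow /(derive_component (half_sheet_differentiable i Ow)) D0.
have r0 := graph_dom_radius Ow.
have D j f : (forall v, half_sheet i v 0 j = f v) -> 'D_h f w = 0.
  by move=> jf; rewrite -(D0 j); congr ('D_h _ w); apply/funext => v;
    rewrite jf.
have Dx : 'D_h xw w = 0 by apply: (D 1) => v; rewrite mxE.
have Dy : 'D_h yw w = 0 by apply: (D 2) => v; rewrite mxE.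
have Dz : 'D_h (fun v => ln (radius2 v)) w = 0 by apply: (D 3) => v;
  rewrite mxE.
have der f : elementary graph_dom f -> is_derive w h f ('D_h f w).
  by move=> ef; apply/derivableP/diff_derivable/(elementary_differentiable ef).
have [/der dc /der ds] := cosw_sinw_elementary graph_dom_radius.
have dr := der _ (radius2_elementary graph_dom).
have rd := elementary_differentiable (radius2_elementary graph_dom) Ow.
have Dr : 'D_h radius2 w = 0.
  move: Dz; rewrite (differentiable_chain h rd (is_derive1_ln r0)).2 => /eqP.
  by rewrite mulf_eq0 invr_eq0 gt_eqF//= => /eqP.
have Ds : is_derive w h (fun v => Num.sqrt (radius2 v)) 0.
  have [dd DD] := differentiable_chain h rd (is_derive1_sqrt r0).
  apply: DeriveDef; first exact: diff_derivable.
  by rewrite DD Dr mulr0.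
pose q := Num.sqrt (radius2 w); have q0 : 0 < q by rewrite sqrtr_gt0.
have nq : \near w, 0 < radius2 w.
  by apply: open_nbhs_nbhs; split; [exact: punctured_open|].
have H j f : (forall v, 0 < radius2 v -> f v * Num.sqrt (radius2 v) = v 0 j) ->
    is_derive w h f ('D_h f w) -> h 0 j = 'D_h f w * q.
  move=> fE df; rewrite -(derive_crd w h j).
  have E : \forall v \near w, (v : 'rV[R]_2) 0 j =
      (f * (fun v : 'rV[R]_2 => Num.sqrt (radius2 v))) v.
    by apply: filterS nq => v rv; rewrite -fE.
  rewrite (near_eq_derive _ E).
  have := @derive_val _ _ _ _ _ _ _ (is_deriveM df Ds).
  by move=> ->; rewrite scaler0 add0r mulrC.
have Hc : h 0 0 = 'D_h cosw w * q.
  by apply: H => // v rv; rewrite divfK// gt_eqF// sqrtr_gt0.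
have Hs : h 0 1 = 'D_h sinw w * q.
  by apply: H => // v rv; rewrite divfK// gt_eqF// sqrtr_gt0.
have cs0 : cosw w * 'D_h cosw w + sinw w * 'D_h sinw w = 0.
  have := Dr.
  have -> : 'D_h radius2 w = 2 * (w 0 0 * h 0 0 + w 0 1 * h 0 1).
    have dj j : is_derive w h (fun v : 'rV[R]_2 => v 0 j) (h 0 j).
      apply: DeriveDef; last exact: derive_crd.
      exact/diff_derivable/differentiable_coord.
    have := @derive_val _ _ _ _ _ _ _
      (is_deriveD (is_deriveM (dj 0) (dj 0)) (is_deriveM (dj 1) (dj 1))).
    by move=> ->; rewrite -!/(_ * _) /GRing.scale/=; ring.
  rewrite Hc Hs => e.
  have qn : q != 0 by rewrite gt_eqF.
  rewrite /cosw /sinw -/q.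
  transitivity (2 * (w 0 0 * ('D_h cosw w * q) + w 0 1 * ('D_h sinw w * q)) /
    (2 * q ^+ 2)); last by rewrite e mul0r.
  by field.
have [Ex Ey] := profile_derive profileP dc ds.
have [c0 s0] : 'D_h cosw w = 0 /\ 'D_h sinw w = 0.
  apply: (profile_immersed profileP (cosw_sinw_circle r0) cs0).
    by rewrite -Dx; have := @derive_val _ _ _ _ _ _ _ Ex => <-.
  by rewrite -Dy; have := @derive_val _ _ _ _ _ _ _ Ey => <-.
apply/rowP => -[[|[|//]] j2]; rewrite mxE.
  by rewrite (_ : Ordinal _ = 0) ?Hc ?c0 ?mul0r//; exact: val_inj.
by rewrite (_ : Ordinal _ = 1) ?Hs ?s0 ?mul0r//; exact: val_inj.
Qed.

Definition polar (z c s : R) : 'rV[R]_2 :=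
  \row_(j < 2) (expR (z / 2) * [:: c; s]`_j).

Lemma radius2_polar z c s : c ^+ 2 + s ^+ 2 = 1 ->
  radius2 (polar z c s) = expR z.
Proof.
move=> cs; rewrite /radius2 !mxE /= !exprMn -mulrDr cs mulr1 expr2 -expRD.
by congr expR; field.
Qed.

Lemma cosw_sinw_polar z c s : c ^+ 2 + s ^+ 2 = 1 ->
  cosw (polar z c s) = c /\ sinw (polar z c s) = s.
Proof.
move=> cs; rewrite /cosw /sinw radius2_polar// sqrt_expR !mxE /=.
by split; rewrite mulrAC divff ?mul1r// gt_eqF// expR_gt0.
Qed.

Lemma polarK w : 0 < radius2 w -> polar (ln (radius2 w)) (cosw w) (sinw w) = w.
Proof.
move=> r0; apply/rowP => -[[|[|//]] j2]; rewrite mxE -sqrt_expR lnK ?posrE//=;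
  rewrite /cosw /sinw mulrC divfK ?gt_eqF ?sqrtr_gt0//; congr (w _ _);
    exact: val_inj.
Qed.

Lemma half_sheet_range X : (exists i w,
  [/\ (i < 2)%N, graph_dom w & half_sheet i w = X]) <->
  (CII R m `\` cone_like_singularities R m) X.
Proof.
split=> [[i [w [_ [r0 t0] <-]]]|[/(CII_dS3 m_ge2)[SX [t [xE yE]]] nc]].
  have tn : crd_t (half_sheet i w) != 0.
    by rewrite !crd_vec4 mulf_neq0// ?signr_eq0// gt_eqF// sqrtr_gt0.
  split; last by move=> /(cone_like_singularity_crd m_ge2)[_ /eqP];
    rewrite (negPf tn).
  apply/(CII_dS3 m_ge2); split; last first.
    have [t [xE yE]] := gamma_of_profile profileP (cosw_sinw_circle r0).
    by exists t; rewrite !crd_vec4.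
  rewrite /dS3/= /lorentz !crd_vec4 -expr2 exprMn sqrr_sign mul1r sqr_sqrtr
    ?ltW//.
  by rewrite /t2w; ring.
have [c [s [cs xc yc]]] := profile_of_gamma profileP t.
pose z := crd_z X; pose w := polar z c s.
have rw : radius2 w = expR z by exact: radius2_polar.
have [cw sw] := cosw_sinw_polar z cs.
have xX : xw w = crd_x X by rewrite /xw cw sw xc xE.
have yX : yw w = crd_y X by rewrite /yw cw sw yc yE.
have tX : t2w w = crd_t X ^+ 2.
  rewrite /t2w xX yX rw expRK /z; move: SX; rewrite /dS3/= /lorentz; lra.
have t0 : crd_t X != 0.
  apply/eqP => t0; apply: nc; apply/(cone_like_singularity_crd m_ge2);
    split => //.
    by apply/(CII_dS3 m_ge2); split => //; exists t.
  have := profile_norm cs; rewrite xc yc -xE -yE.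
  move: SX; rewrite /dS3/= /lorentz t0 => SX nn.
  by apply/eqP; rewrite -sqrf_eq0 eq_le sqr_ge0 andbT; lra.
exists (crd_t X < 0)%R, w; split.
- by case: (_ < _)%R.
- by split; [rewrite rw expR_gt0|rewrite tX exprn_even_gt0].
- rewrite /half_sheet xX yX rw expRK tX sqrtr_sqr -numEsign; exact: vec4_crd.
Qed.

Lemma graph_dom_point : sheets 2 graph_dom.
Proof.
have m0 : m%:R != 0 :> R := m_neq0 m_ge2.
have a0 := amp_gt0 (R := R) m_ge2.
have : (CII R m `\` cone_like_singularities R m) (lightpt m (amp m) (amp m) 0).
  apply: (@swap_lightpt_cone _ _ m_ge2 false); first by rewrite gt_eqF.
  by rewrite mulr0 cos0; ring.
move=> /half_sheet_range/cid[i /cid[w [i2 Ow _]]].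
by exists (i, w); rewrite inE.
Qed.

Definition half_sheets (p : sheets 2 graph_dom) : 'rV[R]_4 :=
  half_sheet (sheet_of p) (sheet_point p).

Lemma half_sheets_continuous : continuous half_sheets.
Proof.
move=> p; have [_ Op] := sheetsP p.
have nd : nbhs p (sheet_dom (sheet_of p)).
  by apply: open_nbhs_nbhs; split => //; exact: sheet_dom_open.
have ch : {for p, continuous (fun q : sheets 2 graph_dom =>
  half_sheet (sheet_of p) (sheet_point q))}.
  apply: (@continuous_comp _ _ _ (@sheet_point _ _ _ _)
    (half_sheet (sheet_of p))).
    exact: sheet_point_continuous.
  exact/differentiable_continuous/half_sheet_differentiable.
have E : \forall q \near p, half_sheet (sheet_of p) (sheet_point q)
  = half_sheets q.
  by near=> q; rewrite /half_sheets (_ : sheet_of q = sheet_of p)//; near: q.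
rewrite /continuous_at; apply: cvg_trans ch.
exact: (@near_eq_cvg _ _ (nbhs p) _ _ _ E).
Unshelve. all: by end_near.
Qed.

(** The sign of t gives the sheet, z gives the radius, and x and y give the
    angle by the continuity of the inverse of the profile. *)
Lemma half_sheets_inverse p A : nbhs p A ->
  exists2 V, nbhs (half_sheets p) V & half_sheets @^-1` V `<=` A.
Proof.
move=> /sheets_nbhs[e e0 eA].
have [i2 [r0 t0]] := sheetsP p.
(* The claim is that every neighbourhood of p belongs to F. *)
pose F : set_system (sheets 2 graph_dom) :=
  filter_from (nbhs (half_sheets p)) (fun V => half_sheets @^-1` V).
have FF : Filter F.
  apply: filter_from_filter; first by exists setT; exact: filterT.
  by move=> V W nV nW; exists (V `&` W) => //; exact: filterI.
have cF (f : 'rV[R]_4 -> R) : continuous f ->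
    (fun q => f (half_sheets q)) @ F --> f (half_sheets p).
  by move=> cf B nB; exists (f @^-1` B) => //; exact: cf.
have [ct cx cy cz] := @crd_continuous R.
have Ft := cF _ ct; have Fx := cF _ cx; have Fy := cF _ cy; have Fz := cF _ cz.
suff [V nV VA] : F A by exists V.
have crd0 q : [/\ crd_t (half_sheets q)
  = (-1) ^+ sheet_of q * Num.sqrt (t2w (sheet_point q)),
    crd_x (half_sheets q) = xw (sheet_point q),
    crd_y (half_sheets q) = yw (sheet_point q) &
    crd_z (half_sheets q) = ln (radius2 (sheet_point q))].
  by rewrite /half_sheets /half_sheet !crd_vec4.
have Fi : \forall q \near F, sheet_of q = sheet_of p.
  have : \forall q \near F, 0 < crd_t (half_sheets q) * crd_t (half_sheets p).
    have Ftt : (fun q => crd_t (half_sheets q) * crd_t (half_sheets p)) @ F -->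
        crd_t (half_sheets p) * crd_t (half_sheets p) by apply: cvgM => //;
          exact: cvg_cst.
    apply: (Ftt [set x | 0 < x]); apply: open_nbhs_nbhs; split;
      first exact: open_gt.
    have [-> _ _ _] := crd0 p; rewrite /= -expr2 exprn_even_gt0//=.
    by rewrite mulf_neq0 ?signr_eq0// gt_eqF// sqrtr_gt0.
  apply: filterS => q; have [-> _ _ _] := crd0 q; have [-> _ _ _] := crd0 p.
  have [q2 [_ tq]] := sheetsP q.
  have tt : 0 < Num.sqrt (t2w (sheet_point q)) * Num.sqrt (t2w (sheet_point p)).
    by rewrite mulr_gt0// sqrtr_gt0.
  rewrite mulrACA (pmulr_lgt0 _ tt).
  move: q2 i2; rewrite -exprD -signr_odd.
  by case: (sheet_of q) => [|[|//]]; case: (sheet_of p) => [|[|//]] //=;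
    rewrite ?expr1 ltr0N1.
have Fcs : (fun q => cosw (sheet_point q)) @ F --> cosw (sheet_point p) /\
    (fun q => sinw (sheet_point q)) @ F --> sinw (sheet_point p).
  have H e' : 0 < e' -> \forall q \near F,
    `|cosw (sheet_point q) - cosw (sheet_point p)| < e' /\
      `|sinw (sheet_point q) - sinw (sheet_point p)| < e'.
    move=> e'0; have [d d0 dP] := profile_inverse profileP
      (cosw_sinw_circle r0) e'0.
    have nx : \forall q \near F, `|xw (sheet_point q) - xw (sheet_point p)| < d.
      have := Fx; have [_ -> _ _] := crd0 p.
      move=> /cvgrPdistC_lt/(_ d d0); apply: filterS => q.
      by have [_ -> _ _] := crd0 q.
    have ny : \forall q \near F, `|yw (sheet_point q) - yw (sheet_point p)| < d.
      have := Fy; have [_ _ -> _] := crd0 p.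
      move=> /cvgrPdistC_lt/(_ d d0); apply: filterS => q.
      by have [_ _ -> _] := crd0 q.
    apply: filterS2 nx ny => q; apply: dP; apply: cosw_sinw_circle.
    by have [_ []] := sheetsP q.
  by split; apply/cvgrPdistC_lt => e' /H; apply: filterS => q [].
have Fw : (fun q => sheet_point q) @ F --> sheet_point p.
  have E q : sheet_point q = polar (crd_z (half_sheets q))
    (cosw (sheet_point q)) (sinw (sheet_point q)).
    by have [_ _ _ ->] := crd0 q; rewrite polarK//; have [_ []] := sheetsP q.
  have Fe : (fun q => expR (crd_z (half_sheets q) / 2)) @ F -->
    expR (crd_z (half_sheets p) / 2).
    apply: continuous_cvg; first exact: continuous_expR.
    by apply: cvgM => //; exact: cvg_cst.
  rewrite [X in _ --> X]E; under eq_fun do rewrite E.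
  apply: cvg_row => -[[|[|//]] j2]; under eq_fun do rewrite mxE /=;
    rewrite mxE /=;
    by apply: cvgM => //; case: Fcs.
have nb : \forall q \near F, ball (sheet_point p) e (sheet_point q).
  by apply: Fw; exact: nbhsx_ballx.
by apply: filterS2 Fi nb => q; exact: eA.
Qed.

Lemma profile_almost_embedded : almost_embedded (dS3 R) (CII R m).
Proof.
exists (cone_like_singularities R m); split.
  exact: discrete_cone_like_singularities.
exists 2%N, (sheets_manifold graph_dom_open graph_dom_point smooth_on_local
  smooth_on_id), half_sheets.
split; last first.
  apply/seteqP; split=> [_ [p _ <-]|X /half_sheet_range[i [w [i2 Ow <-]]]].
    by apply/half_sheet_range; exists (sheet_of p), (sheet_point p);
      have [] := sheetsP p.
  exists (sheet_inv graph_dom_point i w) => //.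
  by rewrite /half_sheets; have [-> ->] := sheet_invP graph_dom_point i2 Ow.
apply: embedding_of_local_inverse.
- apply: (@sheets_immersion _ _ _ _ _ _ _ _ _ _ _ half_sheet) =>
    [i w i2 Ow|i i2|i w i2 Ow].
  + have [] : (CII R m `\` cone_like_singularities R m) (half_sheet i w).
      by apply/half_sheet_range; exists i, w.
    by move=> /(CII_dS3 m_ge2)[].
  + apply: elementary_smooth; first exact: graph_dom_open.
    by move=> j; exact: half_sheet_elementary.
  + split; first exact: half_sheet_differentiable.
    by move=> h; exact: half_sheet_immersed.
- exact: half_sheets_continuous.
- exact: half_sheets_inverse.
Qed.

End Embedding.

(** * The curves for m = 2 and m = 3 *)

Section Profiles.
Context {R : realType}.

Lemma circle_angle (c s : R) : c ^+ 2 + s ^+ 2 = 1 ->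
  exists t, cos t = c /\ sin t = s.
Proof. by move=> /polar_angle[t _ cs]; exists t. Qed.

(** By the formulas for the double angle, - gamma_2 (t) is
    (- g (cos t), g (sin t)) with g (k) = k^3 / 2 + 3 k / 4.  The function g is
    increasing with derivative at least 3 / 4, so its inverse is Lipschitz. *)
Lemma profile2 : circle_profile 2
  (fun c s : R => - (2^-1 * (c * c * c) + 3 / 4 * c))
  (fun c s => 2^-1 * (s * s * s) + 3 / 4 * s)
  (fun c s dc ds => - ((3 / 2 * c ^+ 2 + 3 / 4) * dc))
  (fun c s dc ds => (3 / 2 * s ^+ 2 + 3 / 4) * ds).
Proof.
have E (t : R) : - (2^-1 * (cos t * cos t * cos t) + 3 / 4 * cos t)
  = - gamma_x 2 t /\
    2^-1 * (sin t * sin t * sin t) + 3 / 4 * sin t = - gamma_y 2 t.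
  have cs := cos2Dsin2 t.
  have s2 : sin t ^+ 2 = 1 - cos t ^+ 2 by lra.
  rewrite /gamma_x /gamma_y [2 * t]mulr_natl cos_mulr2n sin_mulr2n; split.
    rewrite (_ : (cos t * sin t) *+ 2 * sin t = 2 * cos t * sin t ^+ 2);
      last by ring.
    by rewrite s2; field.
  have c2 : cos t ^+ 2 = 1 - sin t ^+ 2 by lra.
  rewrite (_ : (cos t * sin t) *+ 2 * cos t = 2 * cos t ^+ 2 * sin t);
    last by ring.
  by rewrite c2; field.
split.
- by move=> t; exists (cos t), (sin t); have [-> ->] := E t; rewrite cos2Dsin2.
- by move=> c s /circle_angle[t [<- <-]]; exists t; exact: E.
- by move=> U f g Ef Eg; split; prove_elementary.
- move=> p h f g df dg Df Dg; split.
    apply: is_derive_eq (is_deriveN (is_deriveD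
      (is_deriveZ 2^-1 (is_deriveM (is_deriveM Df Df) Df))
        (is_deriveZ (3 / 4) Df))) _.
    transitivity (- (2^-1 * (f p * f p * df + f p * (f p * df + f p * df))
      + 3 / 4 * df)).
      by [].
    by field.
  apply: is_derive_eq (is_deriveD
    (is_deriveZ 2^-1 (is_deriveM (is_deriveM Dg Dg) Dg))
      (is_deriveZ (3 / 4) Dg)) _.
  transitivity (2^-1 * (g p * g p * dg + g p * (g p * dg + g p * dg))
    + 3 / 4 * dg).
    by [].
  by field.
- move=> c s dc ds _ _ /eqP + /eqP; rewrite oppr_eq0 !mulf_eq0.
  have k0 (k : R) : 3 / 2 * k ^+ 2 + 3 / 4 != 0 by rewrite gt_eqF//; nra.
  by rewrite !(negPf (k0 _)) => /eqP-> /eqP->.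
- have g_expanding (a b : R) : 3 / 4 * `|a - b| <=
      `|(2^-1 * (a * a * a) + 3 / 4 * a) - (2^-1 * (b * b * b) + 3 / 4 * b)|.
    rewrite [X in _ <= `|X|](_ : _ =
      ((a ^+ 2 + a * b + b ^+ 2) / 2 + 3 / 4) * (a - b)); last by field.
    rewrite normrM ler_wpM2r// ger0_norm; nra.
  move=> c0 s0 e _ e0; exists (e / 2) => [|c s _]; first by rewrite divr_gt0.
  rewrite -opprD normrN => cd sd; split.
    have := g_expanding c c0; lra.
  have := g_expanding s s0; lra.
Qed.

(** The curve gamma_3 depends on 2 t only, so the circle is that of the angle
    2 t, and the x coordinate is 1 - 2 (c + 1)^2 / 3.  Since c >= - 1, it
    determines c; then y, which is 2 s (2 - c) / 3, determines s.  The inverse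
    is only Hoelder continuous, because x has a critical point at c = - 1. *)
Lemma profile3 : circle_profile 3
  (fun c s : R => - (2 / 3 * ((c + 1) * (c + 1)) - 1))
  (fun c s => - (2 / 3 * (s * (c - 2))))
  (fun c s dc ds => - (4 / 3 * (c + 1) * dc))
  (fun c s dc ds => - (2 / 3 * (s * dc + (c - 2) * ds))).
Proof.
have E (t : R) : - (2 / 3 * ((cos (2 * t) + 1) * (cos (2 * t) + 1)) - 1)
  = - gamma_x 3 t /\
    - (2 / 3 * (sin (2 * t) * (cos (2 * t) - 2))) = - gamma_y 3 t.
  have cs := cos2Dsin2 (2 * t).
  rewrite gamma_x_sum// gamma_y_sum//.
  rewrite (_ : (3 + 1) * t = (2 * t) *+ 2); last by ring.
  rewrite (_ : (3 - 1) * t = 2 * t); last by ring.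
  by rewrite cos_mulr2n sin_mulr2n; split; field.
split.
- by move=> t; exists (cos (2 * t)), (sin (2 * t)); have [-> ->] := E t;
    rewrite cos2Dsin2.
- move=> c s /circle_angle[t [<- <-]]; exists (t / 2);
    have [<- <-] := E (t / 2).
  by rewrite (_ : 2 * (t / 2) = t)//; field.
- by move=> U f g Ef Eg; split; prove_elementary.
- move=> p h f g df dg Df Dg.
  have D0 (k : R) := is_derive_cst k p h.
  split.
    apply: is_derive_eq (is_deriveN (is_deriveB (is_deriveZ (2 / 3)
      (is_deriveM (is_deriveD Df (D0 1)) (is_deriveD Df (D0 1)))) (D0 1))) _.
    transitivity (- (2 / 3 * ((f p + 1) * (df + 0) + (f p + 1) * (df + 0)) -
      0)).
      by [].
    by field.
  apply: is_derive_eq (is_deriveN (is_deriveZ (2 / 3)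
    (is_deriveM Dg (is_deriveB Df (D0 2))))) _.
  transitivity (- (2 / 3 * (g p * (df - 0) + (f p - 2) * dg))); first by [].
  by field.
- move=> c s dc ds cs cd.
  have [c1|c1] := eqVneq (c + 1) 0.
    have cE : c = -1 by lra.
    have s0 : s = 0 by nra.
    by move=> _; move: cd; rewrite s0 cE; split; lra.
  move=> /eqP; rewrite oppr_eq0 !mulf_eq0 (negPf c1) orbF /= => dc0.
  have {}dc0 : dc = 0 by apply/eqP; move: dc0; rewrite gt_eqF//; lra.
  rewrite dc0 mulr0 add0r => /eqP; rewrite oppr_eq0 !mulf_eq0 => ds0.
  have c2 : c - 2 != 0 by rewrite lt_eqF//; nra.
  by split=> //; apply/eqP; move: ds0; rewrite (negPf c2) invr_eq0 !pnatr_eq0.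
- move=> c0 s0 e cs0 e0.
  pose a := e / 2; have a0 : 0 < a by rewrite divr_gt0.
  exists (Num.min a (a ^+ 2) / 2) => [|c s cs].
    by rewrite divr_gt0// lt_min a0 exprn_gt0.
  set d := Num.min _ _; have da : d <= a by rewrite ge_min lexx.
  have da2 : d <= a ^+ 2 by rewrite ge_min lexx orbT.
  have [c1 c01] : -1 <= c /\ -1 <= c0 by split; nra.
  have [c2 c02] : c <= 1 /\ c0 <= 1 by split; nra.
  have s01 : `|s0| <= 1 by rewrite ler_norml; apply/andP; split; nra.
  move=> xd yd.
  have cc : `|c - c0| < a.
    (* As c and c0 are at least - 1,
     |c - c0|^2 <= |(c + 1)^2 - (c0 + 1)^2|. *)
  have : `|c - c0| ^+ 2 < a ^+ 2.
      apply: (@le_lt_trans _ _ (`|c - c0| * (c + c0 + 2))).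
        rewrite expr2 ler_wpM2l// ler_norml; apply/andP; split; lra.
      move: xd; rewrite [X in `|X| < _](_ :
        _ = - (2 / 3) * ((c - c0) * (c + c0 + 2)));
        last by ring.
      rewrite normrM normrN (ger0_norm (_ : 0 <= 2 / 3)) ?divr_ge0//.
      rewrite normrM [`|c + c0 + 2|]ger0_norm; nra.
    by rewrite ltr_pXn2r// nnegrE// ltW.
  split; first by rewrite /a in cc; lra.
  have yE : - (2 / 3 * (s * (c - 2))) - - (2 / 3 * (s0 * (c0 - 2))) =
      2 / 3 * ((s - s0) * (2 - c) - s0 * (c - c0)) by ring.
  have : `|s - s0| <= `|(s - s0) * (2 - c)|.
    by rewrite normrM ler_peMr// ger0_norm; lra.
  have : `|(s - s0) * (2 - c)| <=
      `|(s - s0) * (2 - c) - s0 * (c - c0)| + `|s0 * (c - c0)|.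
    by rewrite -{1}[(s - s0) * _](subrK (s0 * (c - c0))) ler_normD.
  have : `|s0 * (c - c0)| <= `|c - c0| by rewrite normrM ler_piMl.
  move: yd; rewrite yE normrM (ger0_norm (_ : 0 <= 2 / 3)) ?divr_ge0//.
  by rewrite /a in cc da *; lra.
Qed.

End Profiles.

Theorem theorem5 (R : realType) (m : nat) (hm : (2 <= m)%N) :
  analytic_extension (dS3 R) (CII R m) (fII_image R m)
  /\
  (* (i) *)
  (xy_projection @` CII R m = hypotrochoid R m /\
   forall a b : R, hypotrochoid R m (Complex a b) ->
     vertical_plane a b `&` cone_like_singularities R m = set0 ->
     is_hyperbola (vertical_section (CII R m) a b))
  /\
  (* (ii) *)
  (almost_immersed (dS3 R) (CII R m) /\
   (endpoints (CII R m) #= `I_4)%card /\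
   (endpoints (CII R m) `&` ideal_boundary_plus R #= `I_2)%card /\
   (endpoints (CII R m) `&` ideal_boundary_minus R #= `I_2)%card /\
   (m = 2%N \/ m = 3%N -> almost_embedded (dS3 R) (CII R m)))
  /\
  (* (iii) *)
  (odd m -> CII R m = closure_dS3 (fII_image R m))
  /\
  (~~ odd m ->
    [/\ (forall X : 'rV[R]_4, iota_dS3 (iota_dS3 X) = X),
        (forall X Y : 'rV[R]_4, lorentz (iota_dS3 X) (iota_dS3 Y) = lorentz X Y),
        closure_dS3 (fII_image R m) `<` CII R m &
        CII R m = closure_dS3 (fII_image R m)
                  `|` iota_dS3 @` closure_dS3 (fII_image R m)]).
Proof.
have [e4 e2 e2'] := card_endpoints (R := R) hm.
split; first exact: CII_analytic_extension.
split.
  by split=> [|a b]; [exact: projection_CII|exact: section_hyperbola].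
split.
  split; first exact: CII_almost_immersed.
  do 3 (split; first by []).
  by move=> [] mE; subst m; [exact: (profile_almost_embedded hm profile2)|
    exact: (profile_almost_embedded hm profile3)].
split; first exact: CII_odd.
move=> em; split.
- exact: iota_dS3K.
- exact: lorentz_iota.
- exact: closure_image_even.
- exact: CII_iota.
Qed.
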